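(* In the setting of the context, assume $\lambda_p:=\mathrm{Gap}(\mathcal{L}^D_p)>0$. Denote $\bar\lambda_x:=\mathrm{Gap}(\mathbb{E}_\rho Q^{rev}(p))$ and, for every $p\in\mathbb{R}^d$, $\lambda_x(p):=\mathrm{Gap}(Q^{rev}(p))$. Then the self-adjoint operator $\hat{\mathcal{L}}^{rev}$ has a spectral gap satisfying $$\min\{\bar\lambda_x,\gamma\lambda_p\}\ \ge\ \mathrm{Gap}(\hat{\mathcal{L}}^{rev})\ \ge\ \lambda^*,$$ where $\lambda^*\in[0,\gamma\lambda_p]$ solves $$\int_{\mathbb{R}^d}\frac{\gamma\lambda_p}{\lambda_x(p)+\gamma\lambda_p-\lambda^*}\,\mathrm{d}\rho(p)=1$$ when $\int_{\mathbb{R}^d}\frac{\gamma\lambda_p}{\lambda_x}\,\mathrm{d}\rho>1$, and $\lambda^*=\gamma\lambda_p$ otherwise.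
   Context: $\mathcal{X}$ is a finite set, $d\ge1$, $\pi\in\mathcal{P}(\mathcal{X})$, $\rho\in\mathcal{P}(\mathbb{R}^d)$, $\hat\pi=\pi\otimes\rho$. For each $p\in\mathbb{R}^d$, $Q(p)\in\mathbb{R}^{\mathcal{X}\times\mathcal{X}}$ satisfies $Q_{x,y}(p)\ge0$ for $x\neq y$, $Q_{x,x}(p)=-\sum_{y\ne x}Q_{x,y}(p)$, and $Q_{x,y}(p)=0$ when $\{x,y\}\not\subset\mathrm{supp}(\pi)$; $\mu:\mathcal{X}\times\mathbb{R}^d\to\mathbb{R}^d$; all components of $Q$ and $\mu$ are in $L^2(\rho)$ as functions of $p$. $\mathcal{L}^D_p$ is the generator of a $\rho$-reversible Markov semigroup on $\mathbb{R}^d$, $\hat{\mathcal{L}}^D_p=\mathrm{Id}\otimes\mathcal{L}^D_p$, $\gamma\ge0$. The operator $$\hat{\mathcal{L}}f(x,p)=\sum_{y}Q_{x,y}(p)f(y,p)+\langle\mu_x(p),\nabla_pf(x,p)\rangle+\gamma\hat{\mathcal{L}}^D_pf(x,p)$$ is the generator of a (uniquely existing) Markov process $(Z_t)_{t\ge0}$ on $\mathcal{X}\times\mathbb{R}^d$, has domain $\hat{\mathcal{D}}\subset L^2(\hat\pi)$, and $C_c^\infty(\mathcal{X}\times\mathbb{R}^d)$ (functions with $f(x,\cdot)$ smooth compactly supported for each $x$) is a core for it. Put $q_x(p)=\sum_{y}Q_{y,x}(p)\pi_y/\pi_x$ for $x\in\mathrm{supp}(\pi)$ and $q_x(p)=0$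 otherwise. It is assumed that $(Z_t)$ is $\hat\pi$-invariant, i.e. for $\pi$-a.e. $x$, $\int\langle\nabla_pf,\mu_x\rangle\,\mathrm{d}\rho=-\int fq_x\,\mathrm{d}\rho$ for all $f\in C_c^\infty(\mathbb{R}^d)$. Reversible part: $Q^\dagger(p)=\mathrm{diag}(1/\pi)Q(p)^\top\mathrm{diag}(\pi)-\mathrm{diag}(q(p))$ (entries $Q_{y,x}(p)\pi_y/\pi_x$ read as $0$ if $\pi_x=0$), $Q^{rev}(p)=\frac12(Q(p)+Q^\dagger(p))$, which is for each $p$ a $\pi$-reversible generator on $\mathcal{X}$, and $\hat{\mathcal{L}}^{rev}f(x,p)=\sum_yQ^{rev}_{x,y}(p)f(y,p)+\gamma\hat{\mathcal{L}}^D_pf(x,p)$ for $f\in C_c^\infty(\mathcal{X}\times\mathbb{R}^d)$. Standing assumption: $\hat{\mathcal{L}}^{rev}$, with domain $\hat{\mathcal{D}}^{rev}\subset L^2(\hat\pi)$, is the self-adjoint operator associated to a closed symmetric Dirichlet form, and $C_c^\infty(\mathcal{X}\times\mathbb{R}^d)$ is a core for it; in particular $\hat{\mathcal{D}}\subset\hat{\mathcal{D}}^{rev}$ and $\langle f,\hat{\mathcal{L}}f\rangle_{L^2(\hat\pi)}=\langle f,\hat{\mathcal{L}}^{rev}f\rangle_{L^2(\hat\pi)}$ for $f\in\hat{\mathcal{D}}$. Spectral gap: for a self-adjoint generator $\mathcal{A}$ on $L^2(\nu)$ with domain $D$, $\mathrm{Gap}(\mathcal{A})=\inf\{-\langle\mathcal{A}f,f\rangle_{L^2(\nu)}/\|f\|^2_{L^2(\nu)}:f\in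 D\setminus\{0\},\ \mathbb{E}_\nu f=0\}$. This is used with $\nu=\hat\pi$ for $\hat{\mathcal{L}}^{rev}$, $\nu=\rho$ for $\mathcal{L}^D_p$, and $\nu=\pi$ for $Q^{rev}(p)$ and $\mathbb{E}_\rho Q^{rev}(p)=\int Q^{rev}(p)\,\mathrm{d}\rho(p)$. In $\int\gamma\lambda_p/\lambda_x\,\mathrm{d}\rho$ the integrand is $+\infty$ where $\lambda_x=0$.
   Formalization: For γ = 0 the equation for λ* (unsolvable when λ_x vanishes on positive mass) is not required, and λ* = 0; also λ_p is taken to be finite, since for λ_p = +∞ (e.g. ρ a point mass) the equation for λ* is undefined. *)

(* Defs.v *)
From HB Require Import structures.
From mathcomp Require Import all_boot all_order all_algebra.
From mathcomp Require Import all_classical all_reals all_analysis.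

Set Implicit Arguments.
Unset Strict Implicit.
Unset Printing Implicit Defensive.
Import Order.TTheory GRing.Theory Num.Theory.
Import numFieldNormedType.Exports.
Local Open Scope classical_set_scope.
Local Open Scope ring_scope.

(* A finite set with its discrete sigma-algebra. The point x0 is there only
   because measurable types are pointed; it carries no other meaning. *)
Definition discr (X : finType) (x0 : X) : Type := X.

Section discr_instances.
Variables (X : finType) (x0 : X).
HB.instance Definition _ := Finite.copy (discr x0) X.
HB.instance Definition _ := isPointed.Build (discr x0) x0.
HB.instance Definition _ := @isMeasurable.Build default_measure_display
  (discr x0) discrete_measurable discrete_measurable0
  discrete_measurableC discrete_measurableU.
End discr_instances.

Section borel_rV.
Variables (R : realType) (d : nat).
HB.instance Definition _ := @isMeasurable.Build
  (sigma_display (@open 'rV[R]_d)) 'rV[R]_d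
  <<s @open 'rV[R]_d >> (@sigma_algebra0 _ setT open) (@sigma_algebraC _ open)
  (@sigma_algebra_bigcup _ setT open).
End borel_rV.

Section L2_operators.
Variables (R : realType) (dT : measure_display) (T : measurableType dT).
Variable nu : probability T R.

Definition L2 (f : T -> R) : Prop := f \in Lfun nu 2%:E.

Definition inner (f g : T -> R) : R := \int[nu]_x (f x * g x).

Definition L2cvg (I : Type) (F : set_system I) (u : I -> T -> R) (f : T -> R)
    : Prop :=
  Lnorm nu 2%:E (fun x => (u i x - f x)%:E) @[i --> F] --> 0%E.

(* An unbounded operator A on L^2(nu) is given by its graph on representatives:
   A f g means that f is in the domain of A and A f = g nu-a.e. *)
Definition L2op := (T -> R) -> (T -> R) -> Prop.

Definition dom (A : L2op) : set (T -> R) := [set f | exists g, A f g].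

Definition L2dense (C : set (T -> R)) : Prop :=
  forall f, L2 f ->
    exists2 u : nat -> T -> R, (forall n, C (u n)) & L2cvg \oo u f.

Definition is_core (A : L2op) (C : set (T -> R)) : Prop :=
  C `<=` dom A /\
  forall f g, A f g -> exists u v : nat -> T -> R,
    [/\ forall n, C (u n), forall n, A (u n) (v n),
        L2cvg \oo u f & L2cvg \oo v g].

Definition self_adjoint (A : L2op) : Prop :=
  [/\ forall f g, A f g -> L2 f /\ L2 g,
      L2dense (dom A) &
      forall f g, L2 f -> L2 g ->
        (A f g <-> forall u v, A u v -> inner f v = inner g u)].

(* The infimum is taken in the extended reals, so it is +oo when there is no
   nonzero centred function in the domain. *)
Definition gap (A : L2op) : \bar R :=
  ereal_inf [set r | exists f g,
    [/\ A f g, inner f f != 0, \int[nu]_x f x = 0 &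
        r = (- inner g f / inner f f)%:E]].

Record symmetric_dirichlet_form (F : set (T -> R))
    (E : (T -> R) -> (T -> R) -> R) : Prop := {
  form_L2 : forall f, F f -> L2 f ;
  form_ae : forall f g, F f -> L2 g -> {ae nu, forall x, f x = g x} ->
    F g /\ forall h, F h -> E f h = E g h ;
  form_dense : L2dense F ;
  form_sub : forall (a : R) f g, F f -> F g -> F (fun x => a * f x + g x) ;
  form_linear : forall (a : R) f g h, F f -> F g -> F h ->
    E (fun x => a * f x + g x) h = a * E f h + E g h ;
  form_sym : forall f g, F f -> F g -> E f g = E g f ;
  form_ge0 : forall f, F f -> 0 <= E f f ;
  form_closed : forall u : nat -> T -> R, (forall n, F (u n)) ->
    (forall e : R, 0 < e -> exists N : nat, forall m n, (N <= m)%N ->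
      (N <= n)%N ->
      let h x := u m x - u n x in E h h + inner h h < e) ->
    exists2 f, F f & forall e : R, 0 < e -> exists N : nat, forall n,
      (N <= n)%N ->
      let h x := u n x - f x in E h h + inner h h < e ;
  form_markov : forall f, F f ->
    let f1 x := Num.min (Num.max (f x) 0) 1 in F f1 /\ E f1 f1 <= E f f
}.

(* The operator A such that E(f, v) = - <A f, v> for all v in F. *)
Definition form_operator (F : set (T -> R)) (E : (T -> R) -> (T -> R) -> R)
    : L2op :=
  fun f g => [/\ F f, L2 g & forall v, F v -> E f v = - inner g v].

Definition sg_act (P : R -> R.-pker T ~> T) (t : R) (f : T -> R) : T -> R :=
  fun x => \int[P t x]_y f y.

(* A Markov transition semigroup preserving nu and strongly continuous on
   L^2(nu). Times are real numbers; only those t >= 0 matter. *)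
Record markov_semigroup (P : R -> R.-pker T ~> T) : Prop := {
  sg_0 : forall x A, measurable A -> P 0 x A = \d_x A ;
  sg_add : forall s t, 0 <= s -> 0 <= t -> forall x A, measurable A ->
    P (s + t) x A = (\int[P s x]_y P t y A)%E ;
  sg_invariant : forall t, 0 <= t -> forall A, measurable A ->
    (\int[nu]_x P t x A)%E = nu A ;
  sg_continuous : forall f, L2 f -> L2cvg 0^'+ (fun t => sg_act P t f) f
}.

Definition reversible (P : R -> R.-pker T ~> T) : Prop :=
  forall t, 0 <= t -> forall A B, measurable A -> measurable B ->
    (\int[nu]_(x in A) P t x B)%E = (\int[nu]_(x in B) P t x A)%E.

Definition generator (P : R -> R.-pker T ~> T) : L2op :=
  fun f g => [/\ L2 f, L2 g &
    L2cvg 0^'+ (fun t x => t^-1 * (sg_act P t f x - f x)) g].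

End L2_operators.

Section smooth.
Variables (R : realType) (d : nat).
Implicit Type f : 'rV[R]_d -> R.

Definition partial (i : 'I_d) f : 'rV[R]_d -> R :=
  fun p => 'D_(delta_mx 0 i) f p.

Definition grad f (p : 'rV[R]_d) : 'rV[R]_d := \row_i partial i f p.

Definition dot (u v : 'rV[R]_d) : R := \sum_i u 0 i * v 0 i.

Definition smooth f : Prop :=
  forall s : seq 'I_d, continuous (foldr partial f s) /\
    forall (i : 'I_d) p, derivable (foldr partial f s) p (delta_mx 0 i).

Definition Cc_infty f : Prop :=
  smooth f /\ compact (closure [set p | f p != 0]).

End smooth.

Section setting.
Variables (R : realType) (X : finType) (x0 : X) (d : nat).
Variables (pi : probability (discr x0) R) (rho : probability 'rV[R]_d R).

Definition pihat : probability (discr x0 * 'rV[R]_d)%type R :=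
  [the probability _ R of (pi \x rho)%E].

Definition wt (x : discr x0) : R := fine (pi [set x]).

Definition Cc_infty_prod (f : discr x0 * 'rV[R]_d -> R) : Prop :=
  forall x, Cc_infty (fun p => f (x, p)).

(* Id (x) A: since X is finite, it is A on every fibre {x} x R^d of positive
   mass. *)
Definition id_tensor (A : L2op R 'rV[R]_d) : L2op R (discr x0 * 'rV[R]_d)%type :=
  fun f g => [/\ L2 pihat f, L2 pihat g &
    {ae pi, forall x, A (fun p => f (x, p)) (fun p => g (x, p))}].

Definition matrix_op (M : discr x0 -> discr x0 -> R) : L2op R (discr x0) :=
  fun f g => forall x, g x = \sum_y M x y * f y.

Variable Q : 'rV[R]_d -> discr x0 -> discr x0 -> R.

Record rate_matrix : Prop := {
  rate_ge0 : forall p x y, x != y -> 0 <= Q p x y ;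
  rate_diag : forall p x, Q p x x = - \sum_(y | y != x) Q p x y ;
  rate_supp : forall p x y, wt x = 0 \/ wt y = 0 -> Q p x y = 0 ;
  rate_L2 : forall x y, L2 rho (fun p => Q p x y)
}.

Definition Qadj (p : 'rV[R]_d) (x y : discr x0) : R :=
  if wt x == 0 then 0 else Q p y x * wt y / wt x.

Definition qvec (x : discr x0) (p : 'rV[R]_d) : R := \sum_y Qadj p x y.

Definition Qdag (p : 'rV[R]_d) (x y : discr x0) : R :=
  Qadj p x y - (if x == y then qvec x p else 0).

Definition Qrev (p : 'rV[R]_d) (x y : discr x0) : R :=
  2^-1 * (Q p x y + Qdag p x y).

Definition EQrev (x y : discr x0) : R := \int[rho]_p Qrev p x y.

Variable mu : discr x0 -> 'rV[R]_d -> 'rV[R]_d.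
Variables (gamma : R) (LD : L2op R 'rV[R]_d).

(* The values of the two operators at f, where g stands for (Id (x) LD) f. *)
Definition Lhat_formula (f g : discr x0 * 'rV[R]_d -> R)
    : discr x0 * 'rV[R]_d -> R :=
  fun z => \sum_y Q z.2 z.1 y * f (y, z.2)
    + dot (mu z.1 z.2) (grad (fun p => f (z.1, p)) z.2) + gamma * g z.

Definition Lrev_formula (f g : discr x0 * 'rV[R]_d -> R)
    : discr x0 * 'rV[R]_d -> R :=
  fun z => \sum_y Qrev z.2 z.1 y * f (y, z.2) + gamma * g z.

Definition acts_on_Cc (A : L2op R (discr x0 * 'rV[R]_d)%type)
    (formula : (discr x0 * 'rV[R]_d -> R) -> (discr x0 * 'rV[R]_d -> R) ->
               discr x0 * 'rV[R]_d -> R) : Prop :=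
  forall f g, Cc_infty_prod f -> id_tensor LD f g -> A f (formula f g).

Definition drift_invariance : Prop :=
  {ae pi, forall x, forall f : 'rV[R]_d -> R, Cc_infty f ->
    \int[rho]_p dot (grad f p) (mu x p) = - \int[rho]_p (f p * qvec x p)}.

Variable lambda_p : R.

Definition lambda_x (p : 'rV[R]_d) : \bar R := gap pi (matrix_op (Qrev p)).

Definition lambda_x_bar : \bar R := gap pi (matrix_op EQrev).

(* In \bar R, 1 / 0 = +oo and 1 / +oo = 0. For gamma = 0 the interval forces
   l = 0; the equation, whose left-hand side is then 0, is not required. *)
Definition is_lambda_star (l : R) : Prop :=
  0 <= l <= gamma * lambda_p /\
  (0 < gamma ->
   if (1 < \int[rho]_p (if lambda_x p == 0 then +oo
                        else (gamma * lambda_p)%:E / lambda_x p))%E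
   then (\int[rho]_p ((gamma * lambda_p)%:E /
           (lambda_x p + (gamma * lambda_p)%:E - l%:E)) = 1)%E
   else l = gamma * lambda_p).

End setting.

(* Main.v *)
Require Import Defs.
From mathcomp Require Import all_boot all_order all_algebra.
From mathcomp Require Import all_classical all_reals all_analysis.
From mathcomp Require Import measurable_realfun ring lra.
Import Order.TTheory GRing.Theory Num.Theory.
Import numFieldNormedType.Exports.
Local Open Scope classical_set_scope.
Local Open Scope ring_scope.
Set Implicit Arguments.
Unset Strict Implicit.
Unset Printing Implicit Defensive.

(** Upper bound: by self-adjointness, testing against the core, [1 (x) h] with [h]
    in the domain of [LD] and [a (x) 1] with [a : X -> R] both lie in the domain of
    [Lrev], with images [gamma (1 (x) LD h)] and [Qrev a]; so no core for [LD] is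
    needed, and these two families of test functions give [gamma lambda_p] and
    [lambda_x_bar].

    Lower bound: write [c = gamma lambda_p] and [l = lambda*]. For [u] in the core put
    [w = u - E_pi u], so that [E_pi w = 0] for each [p]. Since
    [- <Lrev u, u> >= int lambda_x |w|^2 + c sum_x pi_x Var_rho u_x] and
    [c >= l], everything reduces to
    [c (int w_x)^2 <= int (lambda_x + c - l) w_x^2], which is Cauchy-Schwarz with
    the weight [lambda_x + c - l], as [int c / (lambda_x + c - l) <= 1]. *)

(** * Square-integrable functions *)

(** The obstacle is integrability: the rates are only in $L^2(\rho)$, so a rate times an [L2]
    function is merely integrable, and no bound on [lambda_x] is at hand. Hence the jump rates and
    the generator [LD] are moved across an inner product only against core functions, which are
    bounded since they are continuous with compact support; symmetry of [LD] against bounded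
    functions is derived directly from the reversible kernels. For the same reason Cauchy-Schwarz is
    used in linearised form. With $m_x = \int w_x$ and $r = \lambda_x + c - l$, the inequality $2 c
    m_x w_x \le r w_x^2 + c^2 m_x^2 / r$ is summed over $x$ at fixed $p$, where the spectral gap
    bounds $\lambda_x \sum_x \pi_x w_x^2$ by the Dirichlet form. Only then is it integrated in $p$:
    the left side becomes $2 c \sum_x \pi_x m_x^2$, the last term is at most half of that because
    $\int c / r \le 1$, and half is absorbed. Two degenerate cases run through the file: $\lambda_x
    = +\infty$, which happens when no function has positive variance under $\pi$, and $\lambda_x =
    0$ with $l = c$, where the weight $c / r$ is infinite. *)

Section real_integrable.
Context (d : measure_display) (T : measurableType d) (R : realType).
Variable nu : probability T R.
Local Notation ing f := (nu.-integrable setT (EFin \o f)).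
Implicit Types f g : T -> R.

Lemma integrable_addr f g : ing f -> ing g -> ing (fun x => f x + g x).
Proof. by move=> hf hg; apply: eq_integrable (integrableD measurableT hf hg). Qed.

Lemma integrable_scaler a f : ing f -> ing (fun x => a * f x).
Proof. by move=> hf; apply: eq_integrable (integrableZl measurableT a hf). Qed.

Lemma integrable_subr f g : ing f -> ing g -> ing (fun x => f x - g x).
Proof.
move=> hf hg; have := integrable_addr hf (integrable_scaler (-1) hg).
by apply: eq_integrable => // x _ /=; rewrite mulN1r.
Qed.

Lemma integrable_oppr f : ing f -> ing (fun x => - f x).
Proof.
move=> hf; have := integrable_scaler (-1) hf.
by apply: eq_integrable => // x _ /=; rewrite mulN1r.
Qed.

Lemma integrable_cstr a : ing (fun=> a).
Proof. exact: finite_measure_integrable_cst. Qed.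

Lemma integrable_sumr (I : Type) (r : seq I) (F : I -> T -> R) :
  (forall i, ing (F i)) -> ing (fun x => \sum_(i <- r) F i x).
Proof.
move=> hF; elim: r => [|i r IH].
  by under [X in EFin \o X]eq_fun do rewrite big_nil; exact: integrable_cstr.
under [X in EFin \o X]eq_fun do rewrite big_cons.
exact: integrable_addr.
Qed.

Lemma Rintegral_sum (I : Type) (r : seq I) (F : I -> T -> R) :
  (forall i, ing (F i)) ->
  \int[nu]_x (\sum_(i <- r) F i x) = \sum_(i <- r) \int[nu]_x F i x.
Proof.
move=> hF; elim: r => [|i r IH].
  rewrite big_nil; under eq_Rintegral do rewrite big_nil.
  by rewrite Rintegral_cst// mul0r.
rewrite big_cons -IH; under eq_Rintegral do rewrite big_cons.
by rewrite RintegralD//; exact: integrable_sumr.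
Qed.

Lemma Rintegral_cst1 a : \int[nu]_x a = a.
Proof. by rewrite Rintegral_cst// [X in fine X](probability_setT nu) mulr1. Qed.

Lemma integrable_bddM f g (M : R) : measurable_fun setT f -> (forall x, `|f x| <= M) ->
  ing g -> ing (fun x => f x * g x).
Proof.
move=> mf fM hg; have := @integrableMr _ _ _ nu _ measurableT f _ mf _ hg.
move=> H; apply: eq_integrable (H _) => //.
exists M; split; first exact: num_real.
by move=> y My x _ /=; exact: le_trans (fM x) (ltW My).
Qed.

Lemma integrable_bounded f (M : R) : measurable_fun setT f -> (forall x, `|f x| <= M) ->
  ing f.
Proof.
move=> mf fM; have := integrable_bddM mf fM (integrable_cstr 1).
by apply: eq_integrable => // x _ /=; rewrite mulr1.
Qed.

Lemma L2_measurable f : L2 nu f -> measurable_fun setT f.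
Proof. by rewrite /L2 inE => /andP[/[!inE]]. Qed.

Lemma L2P f : L2 nu f <-> measurable_fun setT f /\ ing (fun x => f x ^+ 2).
Proof.
split=> [hf|[mf hf]].
  by split; [exact: L2_measurable|exact: Lfun2_integrable_sqr].
rewrite /L2 inE; apply/andP; split; rewrite inE//=.
rewrite /finite_norm unlock poweR_lty//.
have -> : (\int[nu]_x (`|(f x)%:E| `^ 2) = \int[nu]_x (f x ^+ 2)%:E)%E.
  apply: eq_integral => x _.
  by rewrite abse_EFin poweR_EFin powR_mulrn// real_normK// num_real.
exact: integrable_lty hf.
Qed.

Lemma L2M_integrable f g : L2 nu f -> L2 nu g -> ing (fun x => f x * g x).
Proof. by move=> hf hg; apply/Lfun1_integrable; exact: Lfun2_mul_Lfun1. Qed.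

Lemma L2_cst a : L2 nu (fun=> a).
Proof. exact: Lfun_cst. Qed.

Lemma L2_integrable f : L2 nu f -> ing f.
Proof.
move=> hf; have := L2M_integrable hf (L2_cst 1).
by apply: eq_integrable => // x _ /=; rewrite mulr1.
Qed.

Lemma L2D f g : L2 nu f -> L2 nu g -> L2 nu (fun x => f x + g x).
Proof.
move=> hf hg; apply/L2P; split.
  by apply: measurable_funD; exact: L2_measurable.
have [_ f2] := (L2P f).1 hf; have [_ g2] := (L2P g).1 hg.
have := integrable_addr (integrable_addr f2 g2)
  (integrable_scaler 2 (L2M_integrable hf hg)).
by apply: eq_integrable => // x _ /=; congr EFin; ring.
Qed.

Lemma L2_bddM f g (M : R) : measurable_fun setT f -> (forall x, `|f x| <= M) ->
  L2 nu g -> L2 nu (fun x => f x * g x).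
Proof.
move=> mf fM /L2P[mg g2]; apply/L2P; split; first exact: measurable_funM.
have := integrable_bddM mf fM (integrable_bddM mf fM g2).
by apply: eq_integrable => // x _ /=; congr EFin; ring.
Qed.

Lemma L2_bounded f (M : R) : measurable_fun setT f -> (forall x, `|f x| <= M) ->
  L2 nu f.
Proof.
move=> mf fM; have := L2_bddM mf fM (L2_cst 1).
by under [X in L2 nu X]eq_fun do rewrite mulr1.
Qed.

Lemma L2Z a f : L2 nu f -> L2 nu (fun x => a * f x).
Proof. exact: (@L2_bddM (fun=> a) f `|a|). Qed.

Lemma L2B f g : L2 nu f -> L2 nu g -> L2 nu (fun x => f x - g x).
Proof.
move=> hf hg; have := L2D hf (L2Z (-1) hg).
by under [X in L2 nu X]eq_fun do rewrite mulN1r.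
Qed.

Lemma L2_sum (I : Type) (r : seq I) (F : I -> T -> R) :
  (forall i, L2 nu (F i)) -> L2 nu (fun x => \sum_(i <- r) F i x).
Proof.
move=> hF; elim: r => [|i r IH].
  by under [X in L2 nu X]eq_fun do rewrite big_nil; exact: L2_cst.
by under [X in L2 nu X]eq_fun do rewrite big_cons; exact: L2D.
Qed.

Lemma innerC f g : inner nu f g = inner nu g f.
Proof. by apply: eq_Rintegral => x _; rewrite mulrC. Qed.

Lemma innerBl f g h : L2 nu f -> L2 nu g -> L2 nu h ->
  inner nu (fun x => f x - g x) h = inner nu f h - inner nu g h.
Proof.
move=> hf hg hh; rewrite /inner -RintegralB//; [|exact: L2M_integrable..].
by apply: eq_Rintegral => x _; rewrite mulrBl.
Qed.

Lemma innerDl f g h : L2 nu f -> L2 nu g -> L2 nu h ->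
  inner nu (fun x => f x + g x) h = inner nu f h + inner nu g h.
Proof.
move=> hf hg hh; rewrite /inner -RintegralD//; [|exact: L2M_integrable..].
by apply: eq_Rintegral => x _; rewrite mulrDl.
Qed.

Lemma innerZl a f h : L2 nu f -> L2 nu h ->
  inner nu (fun x => a * f x) h = a * inner nu f h.
Proof.
move=> hf hh; rewrite /inner -RintegralZl//; [|exact: L2M_integrable].
by apply: eq_Rintegral => x _; rewrite mulrA.
Qed.

Lemma inner1 f : inner nu f (fun=> 1) = \int[nu]_x f x.
Proof. by apply: eq_Rintegral => x _; rewrite mulr1. Qed.

(** Jensen for the square: expand the nonnegative integral of [(f x - m) ^+ 2]. *)
Lemma sqr_Rintegral_le f : L2 nu f ->
  (\int[nu]_x f x) ^+ 2 <= \int[nu]_x (f x ^+ 2).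
Proof.
move=> hf; set m := \int[nu]_x f x.
have f2 : ing (fun x => f x ^+ 2) by have [] := (L2P f).1 hf.
have : 0 <= \int[nu]_x (f x - m) ^+ 2 by apply: Rintegral_ge0 => x _; exact: sqr_ge0.
have -> : \int[nu]_x (f x - m) ^+ 2 =
    \int[nu]_x (f x ^+ 2 + ((- 2 * m) * f x + m ^+ 2)).
  by apply: eq_Rintegral => x _; ring.
have hf1 := integrable_scaler (- 2 * m) (L2_integrable hf).
rewrite RintegralD//; last by apply: integrable_addr => //; exact: integrable_cstr.
rewrite RintegralD//; last exact: integrable_cstr.
rewrite RintegralZl//; last exact: L2_integrable.
by rewrite Rintegral_cst1 -/m; nra.
Qed.

(** Hölder with exponents 2 and 2. [f] is merely measurable, so that the bound applies to difference
    quotients of a semigroup before they are known to be square-integrable; if the integral is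
    infinite, [fine] makes the left side 0. *)
Lemma inner_Lnorm f g : measurable_fun setT f -> L2 nu g ->
  (`|inner nu f g|%:E <= Lnorm nu 2%:E (EFin \o f) * Lnorm nu 2%:E (EFin \o g))%E.
Proof.
move=> mf hg; have mg := L2_measurable hg.
have mfg : measurable_fun setT (EFin \o (f \* g)).
  by apply/measurable_EFinP; exact: measurable_funM.
have H := @hoelder _ _ _ nu f g 2 2 mf mg (ltr0n _ _) (ltr0n _ _).
apply: (le_trans _ (H _)); last by rewrite [RHS]splitr !div1r.
rewrite Lnorm1 /inner /Rintegral.
apply: le_trans (le_abse_integral nu measurableT mfg).
have K (y : \bar R) : (`|fine y|%:E <= `|y|)%E.
  by case: y => //=; rewrite ?normr0 ?leey.
exact: K.
Qed.

Lemma L2_Lnorm f : L2 nu f -> Lnorm nu 2%:E (EFin \o f) \is a fin_num.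
Proof.
rewrite ge0_fin_numE ?Lnorm_ge0// /L2 inE => /andP[_].
by rewrite inE.
Qed.

Lemma inner_cvg0 (I : Type) (F : set_system I) {FF : Filter F}
    (u : I -> T -> R) f g :
  (forall i, measurable_fun setT (u i)) -> L2 nu f -> L2 nu g ->
  L2cvg nu F u f -> inner nu (fun x => u i x - f x) g @[i --> F] --> 0.
Proof.
move=> mu hf hg /fine_cvgP[finu uf].
have gfin := L2_Lnorm hg.
set c := fine (Lnorm nu 2%:E (EFin \o g)).
have H : fine (Lnorm nu 2%:E (fun x => (u i x - f x)%:E)) * c @[i --> F] --> 0.
  by rewrite -(mul0r c); apply: cvgMl.
apply: norm_cvg0; apply: (@squeeze_cvgr _ _ _ _ (cst 0) _ _ _ _ _ H).
- near=> i; rewrite normr_ge0/= -lee_fin EFinM fineK//; last by near: i.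
  rewrite fineK//; apply: inner_Lnorm => //.
  by apply: measurable_funB => //; exact: L2_measurable.
- exact: cvg_cst.
Unshelve. all: by end_near. Qed.

Lemma inner_cvg (u v : nat -> T -> R) f g :
  (forall n, L2 nu (u n)) -> (forall n, L2 nu (v n)) -> L2 nu f -> L2 nu g ->
  L2cvg nu \oo u f -> L2cvg nu \oo v g ->
  inner nu (u n) (v n) @[n --> \oo] --> inner nu f g.
Proof.
move=> hu hv hf hg uf vg.
have mu n := L2_measurable (hu n); have mv n := L2_measurable (hv n).
have /fine_cvgP[_ uf'] := uf; have /fine_cvgP[_ vg'] := vg.
have H0 : inner nu (fun x => u n x - f x) (fun x => v n x - g x)
    @[n --> \oo] --> 0.
  have H : fine (Lnorm nu 2%:E (fun x => (u n x - f x)%:E)) *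
      fine (Lnorm nu 2%:E (fun x => (v n x - g x)%:E)) @[n --> \oo] --> 0.
    by rewrite -(mulr0 0); exact: cvgM.
  apply: norm_cvg0; apply: (@squeeze_cvgr _ _ _ _ (cst 0) _ _ _ _ _ H).
  - near=> n; rewrite normr_ge0/= -lee_fin EFinM !fineK//.
    + by apply: inner_Lnorm; [exact: measurable_funB (L2_measurable hf)|exact: L2B].
    + by apply: L2_Lnorm; exact: L2B.
    + by apply: L2_Lnorm; exact: L2B.
  - exact: cvg_cst.
have H1 : inner nu (fun x => u n x - f x) g @[n --> \oo] --> 0.
  exact: inner_cvg0.
have H2 : inner nu (fun x => v n x - g x) f @[n --> \oo] --> 0.
  exact: inner_cvg0.
have -> : (fun n => inner nu (u n) (v n)) = (fun n =>
    inner nu (fun x => u n x - f x) (fun x => v n x - g x) +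
    inner nu (fun x => u n x - f x) g + inner nu (fun x => v n x - g x) f +
    inner nu f g).
  apply/funext => n; have hvg := L2B (hv n) hg.
  rewrite !(innerBl (hu n))// !(innerBl (hv n))//.
  rewrite !(innerC _ (fun x => v n x - g x)) !(innerBl (hv n))//.
  by rewrite !(innerC _ (u n)) !(innerC _ f); ring.
rewrite -[X in _ --> X]add0r -[X in _ --> X + _](addr0 0).
rewrite -[X in _ --> X + _ + _](addr0 0).
by apply: cvgD; [apply: cvgD => //; exact: cvgD|exact: cvg_cst].
Unshelve. all: by end_near. Qed.
End real_integrable.

(** * Reversible kernels *)

Section nonneg_induction.
Context (d : measure_display) (T : measurableType d) (R : realType).
Import HBNNSimple.

(** The standard machine: a nonnegative measurable function is an increasing limit of simple
    functions, each a finite nonnegative combination of indicators. *)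
Lemma nonneg_measurable_ind (P : (T -> R) -> Prop) :
  (forall A, measurable A -> P \1_A) ->
  (forall (c : R) (f : T -> R), 0 <= c -> measurable_fun setT f -> (forall x, 0 <= f x) ->
    P f -> P (fun x => c * f x)) ->
  (forall f g : T -> R, measurable_fun setT f -> (forall x, 0 <= f x) ->
    measurable_fun setT g -> (forall x, 0 <= g x) ->
    P f -> P g -> P (fun x => f x + g x)) ->
  (forall (u : nat -> T -> R) (f : T -> R), (forall n, measurable_fun setT (u n)) ->
    (forall n x, 0 <= u n x) -> (forall x, nondecreasing_seq (u ^~ x)) ->
    (forall x, u n x @[n --> \oo] --> f x) -> measurable_fun setT f ->
    (forall n, P (u n)) -> P f) ->
  forall f : T -> R, measurable_fun setT f -> (forall x, 0 <= f x) -> P f.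
Proof.
move=> P1 PZ PD Plim f mf f0.
have mEf : measurable_fun setT (EFin \o f) by exact/measurable_EFinP.
pose u := nnsfun_approx measurableT mEf.
apply: (Plim (fun n => u n : T -> R)) => //.
- by move=> x m n mn; have /lefP := nd_nnsfun_approx measurableT mEf mn; apply.
- move=> x; apply: (fine_cvg (f := fun n => (u n x)%:E)).
  by apply: cvg_nnsfun_approx => // y _; rewrite lee_fin.
move=> n; move: (u n) => {}u.
(* The coefficient is [|i|] because the scaling hypothesis asks for nonnegative constants; on the
   values that [u] takes it equals [i]. *)
have -> : (u : T -> R) =
    (fun x => \sum_(i <- finmap.enum_fset (fset_set (range u))) (`|i| * \1_(u @^-1` [set i]) x)).
  apply/funext => x; rewrite fimfunE fsbig_finite//=; apply: eq_bigr => i _.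
  have [/= <-|uxi] := pselect (u x = i); first by rewrite ger0_norm.
  by rewrite indicE memNset// !mulr0.
have m1 A : measurable A -> measurable_fun setT (\1_A : T -> R).
  by move=> mA; exact: measurable_indic.
have mpre i : measurable (u @^-1` [set i]) by exact: measurable_sfunP.
elim: (finmap.enum_fset _) => [|i r IH].
  (* The empty sum is obtained as 0 times the indicator of the whole space. *)
  have := PZ 0 \1_setT (lexx _) (m1 _ measurableT) _ (P1 _ measurableT).
  under [X in _ -> P X]eq_fun do rewrite big_nil.
  under [X in (_ -> P X) -> _]eq_fun do rewrite mul0r.
  by apply => x; rewrite indicE.
under eq_fun do rewrite big_cons.
apply: PD => //.
- by apply: measurable_funM => //; exact: m1.
- by apply: measurable_sum => j; apply: measurable_funM => //; exact: m1.
- by move=> x; apply: sumr_ge0 => j _; rewrite mulr_ge0// indicE.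
- by apply: PZ => //; exact: P1.
Qed.

End nonneg_induction.

Section reversible_kernel.
Context (d : measure_display) (T : measurableType d) (R : realType).
Variables (nu : probability T R) (K : R.-pker T ~> T).
Hypothesis K_rev : forall A B, measurable A -> measurable B ->
  (\int[nu]_(x in A) K x B)%E = (\int[nu]_(x in B) K x A)%E.
Local Notation ing f := (nu.-integrable setT (EFin \o f)).
Implicit Types (f g h : T -> R).

Let B f g := (\int[nu]_x \int[K x]_y (f x * g y)%:E)%E.

Let nonneg f := measurable_fun setT f /\ forall x, 0 <= f x.

Let mfst f : measurable_fun setT f ->
  measurable_fun setT (fun z : T * T => f z.1).
Proof. by move=> mf; apply: measurableT_comp. Qed.

Let msnd f : measurable_fun setT f ->
  measurable_fun setT (fun z : T * T => f z.2).
Proof. by move=> mf; apply: measurableT_comp. Qed.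

Let m_int (k : T * T -> R) : measurable_fun setT k -> (forall z, 0 <= k z) ->
  measurable_fun setT (fun x => \int[K x]_y (k (x, y))%:E)%E.
Proof.
move=> mk k0.
apply: (@measurable_fun_integral_sfinite_kernel _ _ _ _ _ (EFin \o k) K) => //.
exact/measurable_EFinP.
Qed.

Let int_ge0 (k : T * T -> R) : (forall z, 0 <= k z) ->
  forall x, setT x -> (0 <= \int[K x]_y (k (x, y))%:E)%E.
Proof. by move=> k0 x _; apply: integral_ge0 => y _; rewrite lee_fin. Qed.

Let m_sec (k : T * T -> R) : measurable_fun setT k ->
  forall x, measurable_fun setT (fun y => (k (x, y))%:E).
Proof. by move=> mk x; apply/measurable_EFinP; exact: measurableT_comp. Qed.

Let intZ (c : R) (k : T * T -> R) : 0 <= c -> measurable_fun setT k ->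
  (forall z, 0 <= k z) ->
  (\int[nu]_x \int[K x]_y (c * k (x, y))%:E =
   c%:E * \int[nu]_x \int[K x]_y (k (x, y))%:E)%E.
Proof.
move=> c0 mk k0; have mI := m_int mk k0; have I0 := int_ge0 k0.
rewrite -ge0_integralZl//; apply: eq_integral => x _.
have ms := m_sec mk x; rewrite -ge0_integralZl// => y _.
by rewrite lee_fin.
Qed.

Let intD (k l : T * T -> R) : measurable_fun setT k -> (forall z, 0 <= k z) ->
  measurable_fun setT l -> (forall z, 0 <= l z) ->
  (\int[nu]_x \int[K x]_y (k (x, y) + l (x, y))%:E =
   \int[nu]_x \int[K x]_y (k (x, y))%:E + \int[nu]_x \int[K x]_y (l (x, y))%:E)%E.
Proof.
move=> mk k0 ml l0; have mI := m_int mk k0; have I0 := int_ge0 k0.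
have mJ := m_int ml l0; have J0 := int_ge0 l0.
rewrite -ge0_integralD//; apply: eq_integral => x _.
have ms := m_sec mk x; have ms' := m_sec ml x.
by rewrite -ge0_integralD// => y _; rewrite lee_fin.
Qed.

Lemma ge0_integral_cvg (mu : {measure set T -> \bar R}) (u : nat -> T -> \bar R)
    (v : T -> \bar R) :
  (forall n, measurable_fun setT (u n)) -> (forall n x, 0 <= u n x)%E ->
  (forall x, nondecreasing_seq (u ^~ x)) -> (forall x, u n x @[n --> \oo] --> v x) ->
  (\int[mu]_x u n x @[n --> \oo] --> \int[mu]_x v x)%E.
Proof.
move=> mu_ u0 ndu uv.
have -> : v = (fun x => limn (u ^~ x)).
  by apply/funext => x; apply/esym/cvg_lim => //; exact: uv.
by apply: cvg_monotone_convergence => // x _; exact: ndu.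
Qed.

Let int_cvg (k : nat -> T * T -> R) (l : T * T -> R) :
  (forall n, measurable_fun setT (k n)) -> (forall n z, 0 <= k n z) ->
  (forall z, nondecreasing_seq (k ^~ z)) -> (forall z, k n z @[n --> \oo] --> l z) ->
  (\int[nu]_x \int[K x]_y (k n (x, y))%:E @[n --> \oo] -->
   \int[nu]_x \int[K x]_y (l (x, y))%:E)%E.
Proof.
move=> mk k0 ndk kl; apply: ge0_integral_cvg.
- by move=> n; exact: m_int.
- by move=> n x; apply: integral_ge0 => y _; rewrite lee_fin.
- move=> x m n mn; have ms := m_sec (mk m) x; have ms' := m_sec (mk n) x.
  by apply: ge0_le_integral => // y _; rewrite lee_fin//; exact: ndk.
- move=> x; apply: ge0_integral_cvg.
  + by move=> n; apply/measurable_EFinP; exact: measurableT_comp.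
  + by move=> n y; rewrite lee_fin.
  + by move=> y m n mn; rewrite lee_fin; exact: ndk.
  + by move=> y; apply: cvg_EFin; [exact: nearW|exact: kl].
Qed.

Let nonneg_tensor f g : nonneg f -> nonneg g ->
  measurable_fun setT (fun z : T * T => f z.1 * g z.2) /\
  forall z : T * T, 0 <= f z.1 * g z.2.
Proof.
move=> [mf f0] [mg g0]; split; last by move=> z; rewrite mulr_ge0.
by apply: measurable_funM; [exact: mfst|exact: msnd].
Qed.

(** The standard machine in one argument; applied once per argument, it carries the symmetry of [B]
    from pairs of sets to pairs of functions. *)
Let B_ind g : nonneg g -> (forall A, measurable A -> B \1_A g = B g \1_A) ->
  forall f, nonneg f -> B f g = B g f.
Proof.
move=> [mg g0] H f [mf f0]; move: f mf f0.
apply: (nonneg_measurable_ind (P := fun f => B f g = B g f)); first exact: H.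
- move=> c f c0 mf f0 E.
  have [mfg fg0] := nonneg_tensor (conj mf f0) (conj mg g0).
  have [mgf gf0] := nonneg_tensor (conj mg g0) (conj mf f0).
  transitivity (c%:E * B f g)%E.
    apply: etrans (intZ c0 mfg fg0).
    by apply: eq_integral => x _; apply: eq_integral => y _; rewrite mulrA.
  rewrite E; apply/esym; apply: etrans (intZ c0 mgf gf0).
  by apply: eq_integral => x _; apply: eq_integral => y _; rewrite mulrCA.
- move=> f h mf f0 mh h0 Ef Eh.
  have [mfg fg0] := nonneg_tensor (conj mf f0) (conj mg g0).
  have [mgf gf0] := nonneg_tensor (conj mg g0) (conj mf f0).
  have [mhg hg0] := nonneg_tensor (conj mh h0) (conj mg g0).
  have [mgh gh0] := nonneg_tensor (conj mg g0) (conj mh h0).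
  transitivity (B f g + B h g)%E.
    apply: etrans (intD mfg fg0 mhg hg0).
    by apply: eq_integral => x _; apply: eq_integral => y _; rewrite mulrDl.
  rewrite Ef Eh; apply/esym; apply: etrans (intD mgf gf0 mgh gh0).
  by apply: eq_integral => x _; apply: eq_integral => y _; rewrite mulrDr.
- move=> u f mu u0 ndu uf mf E.
  have H1 : B (u n) g @[n --> \oo] --> B f g.
    apply: (@int_cvg (fun n z => u n z.1 * g z.2) (fun z => f z.1 * g z.2)).
    + by move=> n; apply: measurable_funM; [exact: mfst|exact: msnd].
    + by move=> n z; rewrite mulr_ge0.
    + by move=> z m n mn; rewrite ler_wpM2r//; exact: ndu.
    + by move=> z; apply: cvgMl; exact: uf.
  have H2 : B g (u n) @[n --> \oo] --> B g f.
    apply: (@int_cvg (fun n z => g z.1 * u n z.2) (fun z => g z.1 * f z.2)).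
    + by move=> n; apply: measurable_funM; [exact: mfst|exact: msnd].
    + by move=> n z; rewrite mulr_ge0.
    + by move=> z m n mn; rewrite ler_wpM2l//; exact: ndu.
    + by move=> z; apply: cvgMr; exact: uf.
  have EB : (fun n => B (u n) g) = (fun n => B g (u n)) by exact/funext.
  by rewrite EB in H1; exact: cvg_unique H1 H2.
Qed.

Let m1 A : measurable A -> nonneg \1_A.
Proof. by move=> mA; split; [exact: measurable_indic|move=> x; rewrite indicE]. Qed.

Let B_indic A C : measurable A -> measurable C -> B \1_A \1_C = B \1_C \1_A.
Proof.
have H A' C' : measurable A' -> measurable C' ->
    B \1_A' \1_C' = (\int[nu]_(x in A') K x C')%E.
  move=> mA mC; rewrite integral_mkcond; apply: eq_integral => x _.
  rewrite patchE; under eq_integral do rewrite EFinM.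
  have mE : measurable_fun setT (fun y => (\1_C' y : R)%:E).
    by apply/measurable_EFinP; exact: measurable_indic.
  rewrite ge0_integralZl//.
  rewrite integral_indic// setIT indicE.
  by case: (x \in A'); rewrite ?mul1e ?mul0e.
by move=> mA mC; rewrite !H// K_rev.
Qed.

Lemma reversible_integral f g : measurable_fun setT f -> (forall x, 0 <= f x) ->
  measurable_fun setT g -> (forall x, 0 <= g x) ->
  (\int[nu]_x \int[K x]_y (f x * g y)%:E =
   \int[nu]_x \int[K x]_y (g x * f y)%:E)%E.
Proof.
move=> mf f0 mg g0; apply: (B_ind (conj mg g0)) (conj mf f0) => A mA; apply/esym.
by apply: (B_ind (m1 mA)) (conj mg g0) => C mC; exact: B_indic.
Qed.

End reversible_kernel.

Section reversible_kernel_inner.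
Context (d : measure_display) (T : measurableType d) (R : realType).
Variables (nu : probability T R) (K : R.-pker T ~> T).
Local Notation ing f := (nu.-integrable setT (EFin \o f)).
Implicit Types (f g h : T -> R).

Local Notation act f := (fun x => \int[K x]_y f y).

Lemma measurable_kernel_act f : measurable_fun setT f ->
  measurable_fun setT (act f).
Proof.
move=> mf; have mEf : measurable_fun setT (EFin \o f) by exact/measurable_EFinP.
apply: (measurableT_comp (f := fine)) => //.
rewrite [X in measurable_fun _ X](_ : _ = fun x =>
    \int[K x]_y (EFin \o f)^\+ y - \int[K x]_y (EFin \o f)^\- y)%E; last first.
  by apply/funext => x; rewrite integralE.
apply: emeasurable_funB.
- apply: measurable_fun_integral_kernel => //; first exact: measurable_kernel.
  exact: measurable_funepos.
- apply: measurable_fun_integral_kernel => //; first exact: measurable_kernel.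
  exact: measurable_funeneg.
Qed.

Lemma kernel_act_cst (c : R) x : \int[K x]_y c = c.
Proof. by rewrite Rintegral_cst// [X in fine X](prob_kernel x) mulr1. Qed.

Lemma kernel_integrable_bounded f (M : R) x : measurable_fun setT f ->
  (forall x, `|f x| <= M) -> (K x).-integrable setT (EFin \o f).
Proof.
move=> mf fM; apply: measurable_bounded_integrable => //.
  by rewrite [ltLHS](prob_kernel x) ltry.
exists M; split; first exact: num_real.
by move=> y My z _ /=; exact: le_trans (fM z) (ltW My).
Qed.

Lemma kernel_act_bounded f (M : R) x : measurable_fun setT f ->
  (forall x, `|f x| <= M) -> `|\int[K x]_y f y| <= M.
Proof.
move=> mf fM; have kf := kernel_integrable_bounded x mf fM.
apply: le_trans (le_normr_Rintegral measurableT kf) _.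
rewrite -[leRHS](kernel_act_cst M x); apply: le_Rintegral => //.
  exact: integrable_norm.
apply: (@kernel_integrable_bounded _ `|M|) => //.
Qed.

Hypothesis K_rev : forall A B, measurable A -> measurable B ->
  (\int[nu]_(x in A) K x B)%E = (\int[nu]_(x in B) K x A)%E.

(** Invariance is reversibility tested against the constant 1. *)
Lemma reversible_invariant f : measurable_fun setT f -> (forall x, 0 <= f x) ->
  (\int[nu]_x \int[K x]_y (f y)%:E = \int[nu]_x (f x)%:E)%E.
Proof.
move=> mf f0; have := @reversible_integral _ _ _ nu K K_rev (cst 1) f.
move=> /(_ (measurable_cst _) (fun=> ler01) mf f0) E.
transitivity (\int[nu]_x \int[K x]_y (cst 1 x * f y)%:E)%E.
  by apply: eq_integral => x _; apply: eq_integral => y _; rewrite mul1r.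
rewrite E; apply: eq_integral => x _; rewrite /= mulr1.
by rewrite integral_cst// [X in (_ * X)%E](prob_kernel x) mule1.
Qed.

Lemma kernel_abs_lty f : ing f ->
  (\int[nu]_x \int[K x]_y `|(f y)%:E| < +oo)%E.
Proof.
move=> /integrableP[mf foo]; have {}mf := (measurable_EFinP _ _).1 mf.
by rewrite (@reversible_invariant (fun x => `|f x|))//; exact: measurableT_comp.
Qed.

(** By invariance the integral of [|f|] under [K x] has finite mean. Outside this set of full
    measure [act f x] may be the default value of [fine], so identities involving [act f] hold
    almost everywhere only. *)
Lemma kernel_integrable_ae f : ing f ->
  {ae nu, forall x, (K x).-integrable setT (EFin \o f)}.
Proof.
move=> hf; have /integrableP[mEf foo] := hf.
have mf := (measurable_EFinP _ _).1 mEf.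
have H : nu.-integrable setT (fun x => \int[K x]_y `|(f y)%:E|)%E.
  apply/integrableP; split.
    apply: measurable_fun_integral_kernel => //; first exact: measurable_kernel.
    exact: measurableT_comp.
  under eq_integral do rewrite gee0_abs ?integral_ge0//.
  exact: kernel_abs_lty.
have := integrable_ae measurableT H; apply: filterS => x /(_ Logic.I) fin.
by apply/integrableP; split=> //; rewrite ltey_eq fin.
Qed.

Lemma integrable_kernel_act f : ing f -> ing (act f).
Proof.
move=> hf; have /integrableP[mEf foo] := hf.
have mf := (measurable_EFinP _ _).1 mEf.
apply/integrableP; split.
  by apply/measurable_EFinP; exact: measurable_kernel_act.
have m1 : measurable_fun setT (fun x => `|(act f x)%:E|)%E.
  by apply: measurableT_comp => //; apply/measurable_EFinP; exact: measurable_kernel_act.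
have m2 : measurable_fun setT (fun x => \int[K x]_y `|(f y)%:E|)%E.
  apply: measurable_fun_integral_kernel => //; first exact: measurable_kernel.
  exact: measurableT_comp.
apply: le_lt_trans (kernel_abs_lty hf); apply: ge0_le_integral => // x _.
apply: le_trans (le_abse_integral (K x) measurableT mEf).
rewrite /Rintegral /=.
by case: (\int[K x]_y (f y)%:E)%E => //=; rewrite ?normr0 ?leey.
Qed.

Lemma ae_eq_Rintegral f g : measurable_fun setT f -> measurable_fun setT g ->
  {ae nu, forall x, f x = g x} -> \int[nu]_x f x = \int[nu]_x g x.
Proof.
move=> mf mg fg; congr fine; apply: ae_eq_integral => //.
- exact/measurable_EFinP.
- exact/measurable_EFinP.
- by apply: filterS fg => x -> _.
Qed.

Let sym_ge0 f g (M : R) : ing f -> (forall x, 0 <= f x) ->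
  measurable_fun setT g -> (forall x, 0 <= g x) -> (forall x, `|g x| <= M) ->
  inner nu f (act g) = inner nu (act f) g.
Proof.
move=> hf f0 mg g0 gM; have mf := (measurable_EFinP _ _).1 (measurable_int _ hf).
have E := reversible_integral K_rev mf f0 mg g0.
congr fine; transitivity (\int[nu]_x \int[K x]_y (f x * g y)%:E)%E.
  apply: eq_integral => x _; have kg := kernel_integrable_bounded x mg gM.
  under [RHS]eq_integral do rewrite EFinM.
  rewrite integralZl// EFinM /Rintegral fineK//.
  exact: integrable_fin_num.
rewrite E; apply: ae_eq_integral => //.
- apply: (@measurable_fun_integral_sfinite_kernel _ _ _ _ _
    (fun z => (g z.1 * f z.2)%:E) K).
    by move=> z; rewrite lee_fin mulr_ge0.
  apply/measurable_EFinP; apply: measurable_funM; exact: measurableT_comp.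
- apply/measurable_EFinP; apply: measurable_funM => //.
  exact: measurable_kernel_act.
- apply: filterS (kernel_integrable_ae hf) => x kf _.
  under eq_integral do rewrite EFinM.
  rewrite integralZl// muleC EFinM /Rintegral fineK//.
  exact: integrable_fin_num.
Qed.

Let sym_r_ge0 f g (M : R) : ing f ->
  measurable_fun setT g -> (forall x, 0 <= g x) -> (forall x, `|g x| <= M) ->
  inner nu f (act g) = inner nu (act f) g.
Proof.
move=> hf mg g0 gM; have mf := (measurable_EFinP _ _).1 (measurable_int _ hf).
have hp : ing f^\+ by exact: integrable_funrpos.
have hn : ing f^\- by exact: integrable_funrneg.
have Ep := sym_ge0 hp (funrpos_ge0 f) mg g0 gM.
have En := sym_ge0 hn (funrneg_ge0 f) mg g0 gM.
have mKg := measurable_kernel_act mg.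
have KgM x : `|act g x| <= M by exact: kernel_act_bounded.
transitivity (inner nu f^\+ (act g) - inner nu f^\- (act g)).
  rewrite /inner -RintegralB//.
  - by apply: eq_Rintegral => x _; rewrite -mulrBl -[in LHS](funrposBneg f).
  - by under [X in EFin \o X]eq_fun do rewrite mulrC; exact: integrable_bddM hp.
  - by under [X in EFin \o X]eq_fun do rewrite mulrC; exact: integrable_bddM hn.
have hKp := integrable_kernel_act hp; have hKn := integrable_kernel_act hn.
rewrite Ep En /inner -RintegralB//; last 2 first.
- by under [X in EFin \o X]eq_fun do rewrite mulrC; exact: integrable_bddM hKp.
- by under [X in EFin \o X]eq_fun do rewrite mulrC; exact: integrable_bddM hKn.
apply: ae_eq_Rintegral.
- have mp := measurable_kernel_act (measurable_funrpos mf).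
  have mn := measurable_kernel_act (measurable_funrneg mf).
  by apply: measurable_funB; apply: measurable_funM.
- by apply: measurable_funM => //; exact: measurable_kernel_act.
- apply: filterS2 (kernel_integrable_ae hp) (kernel_integrable_ae hn).
  move=> x kp kn; rewrite -mulrBl -RintegralB//; congr (_ * _).
  by apply: eq_Rintegral => y _; rewrite -[in RHS](funrposBneg f).
Qed.

(** An integrable function against a bounded one: the kernel preserves both classes, so every
    product below is integrable. *)
Lemma reversible_inner f g (M : R) : ing f ->
  measurable_fun setT g -> (forall x, `|g x| <= M) ->
  inner nu f (act g) = inner nu (act f) g.
Proof.
move=> hf mg gM.
have hKf := integrable_kernel_act hf.
have mKg := measurable_kernel_act mg.
have KgM x : `|act g x| <= M by exact: kernel_act_bounded.
(* The shift makes [g] nonnegative, as [sym_r_ge0] demands; the two terms in [M] that it creates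
   agree by the same lemma for the constant 1. *)
pose gg x := g x + M.
have mgg : measurable_fun setT gg by exact: measurable_funD.
have gg0 x : 0 <= gg x.
  by rewrite /gg -lerBlDr sub0r; have := gM x; rewrite ler_norml => /andP[].
have ggM x : `|gg x| <= M + `|M| by apply: le_trans (ler_normD _ _) _; rewrite lerD2r.
have := sym_r_ge0 hf mgg gg0 ggM.
have -> : inner nu f (act gg) = inner nu f (act g) + M * \int[nu]_x f x.
  rewrite /inner -RintegralZl// -RintegralD//.
  - apply: eq_Rintegral => x _; rewrite [M * _]mulrC -mulrDr; congr (_ * _).
    rewrite RintegralD//.
    + by rewrite kernel_act_cst.
    + exact: kernel_integrable_bounded gM.
    + exact: (@kernel_integrable_bounded _ `|M|).
  - by under [X in EFin \o X]eq_fun do rewrite mulrC; exact: integrable_bddM hf.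
  - exact: integrable_scaler.
have -> : inner nu (act f) gg = inner nu (act f) g + M * \int[nu]_x act f x.
  rewrite /inner -RintegralZl// -RintegralD//.
  - by apply: eq_Rintegral => x _; rewrite [M * _]mulrC -mulrDr.
  - by under [X in EFin \o X]eq_fun do rewrite mulrC; exact: integrable_bddM hKf.
  - exact: integrable_scaler.
have := @sym_r_ge0 f (fun=> 1) 1 hf (measurable_cst _) (fun=> ler01).
rewrite normr1 => /(_ (fun=> lexx _)).
rewrite /inner; under eq_Rintegral do rewrite kernel_act_cst mulr1.
under [in RHS]eq_Rintegral do rewrite mulr1.
by move=> ->; exact: addIr.
Qed.

End reversible_kernel_inner.

(** * Generators of reversible Markov semigroups *)

Section generator.
Context (d : measure_display) (T : measurableType d) (R : realType).
Variables (nu : probability T R) (P : R -> R.-pker T ~> T).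
Hypothesis P_rev : reversible nu P.
Implicit Types (f g u v : T -> R).

(** At each [t > 0] reversibility gives [inner (D f t) u = inner (D u t) f]. So the difference of
    the two error terms [H1] and [H2], which tends to 0, is the constant [inner f v - inner g u].
    Boundedness of [u] is what makes [reversible_inner] applicable, while [f] ranges over the whole
    domain. *)
Lemma generator_sym f g u v (M : R) : generator nu P f g -> generator nu P u v ->
  (forall x, `|u x| <= M) -> inner nu f v = inner nu g u.
Proof.
move=> [hf hg fg] [hu hv uv] uM.
have mu := L2_measurable hu; have mf := L2_measurable hf.
pose D (w : T -> R) t x := t^-1 * (sg_act P t w x - w x).
have mD w : measurable_fun setT w -> forall t, measurable_fun setT (D w t).
  move=> mw t; apply: measurable_funM => //; apply: measurable_funB => //.
  exact: measurable_kernel_act.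
have H1 : inner nu (fun x => D u t x - v x) f @[t --> 0^'+] --> 0.
  by apply: inner_cvg0 => //; exact: mD.
have H2 : inner nu (fun x => D f t x - g x) u @[t --> 0^'+] --> 0.
  by apply: inner_cvg0 => //; exact: mD.
have H : inner nu (fun x => D f t x - g x) u - inner nu (fun x => D u t x - v x) f
    @[t --> 0^'+] --> 0 - 0 by exact: cvgB.
rewrite subr0 in H.
have H' : inner nu f v - inner nu g u @[t --> (0:R)^'+] --> 0.
  apply: cvg_trans H; apply: near_eq_cvg; near=> t.
  have t0 : 0 < t by near: t; exact: nbhs_right_gt.
  have rt A B := @P_rev t (ltW t0) A B.
  have hf1 := L2_integrable hf; have hKf := integrable_kernel_act rt hf1.
  have Ku x : `|sg_act P t u x| <= M by exact: kernel_act_bounded.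
  have mKu : measurable_fun setT (sg_act P t u) by exact: measurable_kernel_act.
  have hKu : L2 nu (sg_act P t u) by exact: L2_bounded mKu Ku.
  have hDu : L2 nu (D u t) by apply: L2Z; exact: L2B.
  rewrite [X in _ - X]innerBl// [inner nu v f]innerC.
  have E := reversible_inner rt hf1 mu uM.
  have -> : inner nu (fun x => D f t x - g x) u = inner nu (D f t) u - inner nu g u.
    rewrite /inner -RintegralB//; first by apply: eq_Rintegral => x _; rewrite mulrBl.
      under [X in EFin \o X]eq_fun do rewrite mulrC.
      apply: integrable_bddM uM _ => //; apply: integrable_scaler.
      exact: integrable_subr.
    exact: L2M_integrable.
  suff -> : inner nu (D f t) u = inner nu (D u t) f by ring.
  transitivity (t^-1 * (inner nu (sg_act P t f) u - inner nu f u)).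
    rewrite /inner -RintegralB//; last 2 first.
    - under [X in EFin \o X]eq_fun do rewrite mulrC.
      exact: integrable_bddM mu uM hKf.
    - exact: L2M_integrable.
    rewrite -RintegralZl//.
      by apply: eq_Rintegral => x _; rewrite /D -mulrA mulrBl.
    apply: integrable_subr; last exact: L2M_integrable.
    under [X in EFin \o X]eq_fun do rewrite mulrC.
    exact: integrable_bddM mu uM hKf.
  rewrite /D innerZl//; last exact: L2B.
  by rewrite innerBl// [inner nu _ f]innerC E [inner nu u f]innerC.
apply/eqP; rewrite -subr_eq0; apply/eqP.
have Hc : inner nu f v - inner nu g u @[t --> (0:R)^'+] -->
    inner nu f v - inner nu g u by exact: cvg_cst.
exact: (cvg_unique _ Hc H').
Unshelve. all: by end_near. Qed.

Lemma L2cvg_cst (I : Type) (F : set_system I) {FF : Filter F} f :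
  L2cvg nu F (fun=> f) f.
Proof.
rewrite /L2cvg (_ : (fun x => (f x - f x)%:E) = cst 0%E) ?Lnorm0//.
  exact: cvg_cst.
by apply/funext => x; rewrite subrr.
Qed.

Lemma generator_cst (c : R) : generator nu P (fun=> c) (fun=> 0).
Proof.
split; [exact: L2_cst|exact: L2_cst|].
rewrite [X in L2cvg _ _ X](_ : _ = fun _ _ => 0); first exact: L2cvg_cst.
by apply/funext => t; apply/funext => x; rewrite /sg_act kernel_act_cst subrr mulr0.
Qed.

(** A bounded [u] is integrable under every [P t x], so the constant cancels in the difference
    quotient at every point. *)
Lemma generator_subc u v (c M : R) : (forall x, `|u x| <= M) ->
  generator nu P u v -> generator nu P (fun x => u x - c) v.
Proof.
move=> uM [hu hv uv]; have mu := L2_measurable hu.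
split=> //; first by apply: L2B => //; exact: L2_cst.
congr (L2cvg _ _ _ _): uv; apply/funext => t; apply/funext => x.
rewrite /sg_act RintegralB//.
- by rewrite kernel_act_cst; ring.
- exact: kernel_integrable_bounded uM.
- exact: (@kernel_integrable_bounded _ _ _ _ _ `|c|).
Qed.

End generator.

(** * Product with a finite space *)

Section product_space.
Variables (R : realType) (X : finType) (x0 : X) (d : nat).
Variables (pi : probability (discr x0) R) (rho : probability 'rV[R]_d R).
Local Notation S := (discr x0).
Local Notation wt := (wt pi).
Local Notation nu := (pihat pi rho).
Local Notation ing m f := (m.-integrable setT (EFin \o f)).

Lemma discr_measurable_fun (dU : measure_display) (U : measurableType dU)
  (f : S -> U) : measurable_fun setT f.
Proof. by move=> mS Y mY. Qed.

Lemma wt_ge0 x : 0 <= wt x.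
Proof. exact: fine_ge0. Qed.

Lemma integral_discr (f : S -> \bar R) : (forall x, 0 <= f x)%E ->
  (\int[pi]_x f x = \sum_x (wt x)%:E * f x)%E.
Proof.
move=> f0.
transitivity (\int[pi]_x \sum_y (f y * (\1_[set y] x)%:E))%E.
  apply: eq_integral => x _; rewrite (bigD1 x)//= indicE mem_set// mule1.
  rewrite big1 ?adde0// => y yx; rewrite indicE memNset ?mule0// => xy.
  by rewrite xy eqxx in yx.
rewrite ge0_integral_sum//; last first.
- by move=> y x _; apply: mule_ge0 => //; rewrite lee_fin indicE.
- apply: eq_bigr => y _.
  have mI : measurable_fun setT (fun x : S => (\1_[set y] x : R)%:E).
    exact: discr_measurable_fun.
  rewrite ge0_integralZl//.
  rewrite integral_indic// setIT muleC /Defs.wt fineK//.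
  exact: fin_num_measure.
Qed.

Lemma Rintegral_indic (dT : measure_display) (T : measurableType dT)
    (m : {measure set T -> \bar R}) (A : set T) : measurable A ->
  \int[m]_x \1_A x = fine (m A).
Proof. by move=> mA; rewrite /Rintegral integral_indic// setIT. Qed.

Lemma integrable_discr (f : S -> R) : ing pi f.
Proof.
apply: (@integrable_bounded _ _ _ _ _ (\sum_x `|f x|)).
  exact: discr_measurable_fun.
by move=> x; rewrite (bigD1 x)//= lerDl sumr_ge0.
Qed.

Lemma Rintegral_discr (f : S -> R) : \int[pi]_x f x = \sum_x wt x * f x.
Proof.
transitivity (\int[pi]_x \sum_y (f y * \1_[set y] x)).
  apply: eq_Rintegral => x _; rewrite (bigD1 x)//= indicE mem_set// mulr1.
  rewrite big1 ?addr0// => y yx; rewrite indicE memNset ?mulr0// => xy.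
  by rewrite xy eqxx in yx.
rewrite Rintegral_sum; last by move=> y; exact: integrable_discr.
apply: eq_bigr => y _; rewrite RintegralZl//; last exact: integrable_discr.
by rewrite Rintegral_indic// mulrC.
Qed.

Lemma sum_wt : \sum_x wt x = 1.
Proof.
have := Rintegral_discr (fun=> 1); rewrite Rintegral_cst1 => ->.
by apply: eq_bigr => x _; rewrite mulr1.
Qed.

Lemma measurable_sections (f : S * 'rV[R]_d -> R) :
  (forall x, measurable_fun setT (fun p => f (x, p))) -> measurable_fun setT f.
Proof.
move=> mf _ Y mY; rewrite setTI.
have -> : f @^-1` Y = \big[setU/set0]_(x : S)
    ([set x] `*` ((fun p => f (x, p)) @^-1` Y)).
  apply/seteqP; split => [[x p] /= fY|[x p]].
    by rewrite (bigD1 x)//=; left.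
  by rewrite -bigcup_seq => -[y _ [/= -> ]].
apply: bigsetU_measurable => x _; apply: measurableX => //.
by rewrite -[X in measurable X]setTI; exact: mf.
Qed.

Lemma integrable_sections (f : S * 'rV[R]_d -> R) :
  (forall x, ing rho (fun p => f (x, p))) -> ing nu f.
Proof.
move=> hf.
have mf : measurable_fun setT f.
  apply: measurable_sections => x; apply/measurable_EFinP.
  exact: measurable_int (hf x).
apply/integrableP; split; first exact/measurable_EFinP.
rewrite fubini_tonelli1//; last first.
  by apply: measurableT_comp => //; exact/measurable_EFinP.
rewrite integral_discr; last by move=> x; exact: integral_ge0.
apply: lte_sum_pinfty => x _; apply: lte_mul_pinfty => //.
- by rewrite lee_fin wt_ge0.
- by have /integrableP[] := hf x.
Qed.

Lemma Rintegral_sections (f : S * 'rV[R]_d -> R) :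
  (forall x, ing rho (fun p => f (x, p))) ->
  \int[nu]_z f z = \sum_x wt x * \int[rho]_p f (x, p).
Proof.
move=> hf; have hfn := integrable_sections hf.
rewrite -Rintegral_discr {1}/Rintegral.
rewrite -(@integral12_prod_meas1 _ _ _ _ _ pi rho _ hfn).
congr fine; apply: eq_integral => x _; rewrite /fubini_F /Rintegral fineK//.
exact: integrable_fin_num (hf x).
Qed.

Lemma L2_sections (f : S * 'rV[R]_d -> R) :
  (forall x, L2 rho (fun p => f (x, p))) -> L2 nu f.
Proof.
move=> hf; apply/L2P; split.
  by apply: measurable_sections => x; exact: L2_measurable.
apply: integrable_sections => x.
by have [] := (L2P rho (fun p => f (x, p))).1 (hf x).
Qed.

Lemma inner_sections (f g : S * 'rV[R]_d -> R) :
  (forall x, L2 rho (fun p => f (x, p))) -> (forall x, L2 rho (fun p => g (x, p))) ->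
  inner nu f g = \sum_x wt x * inner rho (fun p => f (x, p)) (fun p => g (x, p)).
Proof. by move=> hf hg; apply: Rintegral_sections => x; exact: L2M_integrable. Qed.

End product_space.

(** * Finite reversible rate matrices *)

Section dirichlet_form.
Variables (R : realType) (X : finType) (x0 : X).
Variable pi : probability (discr x0) R.
Local Notation S := (discr x0).
Local Notation wt := (wt pi).
Implicit Types (M : S -> S -> R) (f g : S -> R).

Definition mean f := \sum_x wt x * f x.
Definition variance f := \sum_x wt x * (f x - mean f) ^+ 2.
Definition dirichlet M f := - \sum_x wt x * ((\sum_y M x y * f y) * f x).

Definition reversible_rates M := [/\ forall x y, wt x * M x y = wt y * M y x,
  forall x, \sum_y M x y = 0 & forall x y, x != y -> 0 <= M x y].

Lemma variance_ge0 f : 0 <= variance f.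
Proof. by apply: sumr_ge0 => x _; rewrite mulr_ge0 ?wt_ge0 ?sqr_ge0. Qed.

Lemma mean_subc f c : mean (fun x => f x - c) = mean f - c.
Proof.
rewrite /mean; under eq_bigr do rewrite mulrBr.
by rewrite sumrB -mulr_suml sum_wt mul1r.
Qed.

(** Zero row sums make [M] kill constants; with detailed balance they also make [M f] centred. *)
Lemma dirichlet_subc M f c : reversible_rates M ->
  dirichlet M (fun x => f x - c) = dirichlet M f.
Proof.
move=> [sym row0 _]; congr (- _).
have E x : \sum_y M x y * (f y - c) = \sum_y M x y * f y.
  under eq_bigr do rewrite mulrBr.
  by rewrite sumrB -mulr_suml row0 mul0r subr0.
under eq_bigr do rewrite E !mulrBr.
rewrite sumrB; under [X in _ - X]eq_bigr do rewrite mulrA.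
rewrite -mulr_suml.
have -> : \sum_x wt x * (\sum_y M x y * f y) = 0.
  under eq_bigr do rewrite mulr_sumr.
  rewrite exchange_big/= big1// => y _.
  under eq_bigr do rewrite mulrA sym -mulrA [M _ _ * _]mulrC mulrA.
  by rewrite -mulr_sumr row0 mulr0.
by rewrite mul0r subr0.
Qed.

(** On expanding the square, both diagonal sums vanish by the row sums, after detailed balance swaps
    the roles of [x] and [y] in one of them. Nonnegativity of the form is read off from here. *)
Lemma dirichletE M f : reversible_rates M ->
  dirichlet M f = 2^-1 * \sum_x \sum_y wt x * M x y * (f x - f y) ^+ 2.
Proof.
move=> [sym row0 _].
have -> : \sum_x \sum_y wt x * M x y * (f x - f y) ^+ 2 =
   \sum_x \sum_y (wt x * f x ^+ 2 * M x y) +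
   \sum_x \sum_y (wt y * f y ^+ 2 * M y x) -
   2 * \sum_x wt x * ((\sum_y M x y * f y) * f x).
  rewrite mulr_sumr -big_split -sumrB/=; apply: eq_bigr => x _.
  rewrite mulr_suml mulrA !mulr_sumr -big_split -sumrB/=; apply: eq_bigr => y _.
  have -> : wt y * f y ^+ 2 * M y x = f y ^+ 2 * (wt y * M y x) by ring.
  by rewrite (sym y x); ring.
rewrite [X in _ + X - _]exchange_big/=.
have E : \sum_x \sum_y (wt x * f x ^+ 2 * M x y) = 0.
  by rewrite big1// => x _; rewrite -mulr_sumr row0 mulr0.
by rewrite E /dirichlet; field.
Qed.

Lemma dirichlet_ge0 M f : reversible_rates M -> 0 <= dirichlet M f.
Proof.
move=> hM; rewrite dirichletE//; have [_ _ off] := hM.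
apply: mulr_ge0 => //; apply: sumr_ge0 => x _; apply: sumr_ge0 => y _.
have [->|xy] := eqVneq x y; first by rewrite subrr expr0n mulr0.
apply: mulr_ge0; last exact: sqr_ge0.
by apply: mulr_ge0; [exact: wt_ge0|exact: off].
Qed.

(** Centring [f] changes neither side. Together with [gap_matrix_ge] this writes the gap as an
    infimum over all functions of nonzero variance, free of the constraint of mean zero. *)
Lemma gap_matrix_le M f : reversible_rates M -> variance f != 0 ->
  (gap pi (matrix_op M) <= (dirichlet M f / variance f)%:E)%E.
Proof.
move=> hM vf; pose f0 x := f x - mean f.
have E0 : inner pi f0 f0 = variance f.
  by rewrite /inner Rintegral_discr; apply: eq_bigr => x _; rewrite -expr2.
apply: ereal_inf_lbound; exists f0, (fun x => \sum_y M x y * f0 y).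
rewrite E0; split => //.
  by rewrite Rintegral_discr -/(mean _) mean_subc subrr.
rewrite -(dirichlet_subc f (mean f) hM) /inner Rintegral_discr.
by congr ((_ / _)%:E).
Qed.

Lemma gap_matrix_ge M (c : \bar R) :
  (forall f, variance f != 0 -> (c <= (dirichlet M f / variance f)%:E)%E) ->
  (c <= gap pi (matrix_op M))%E.
Proof.
move=> H; apply: le_ereal_inf_tmp => _ [f [g [/= Mfg ff f0 ->]]].
have m0 : mean f = 0 by rewrite /mean -Rintegral_discr.
have E : variance f = inner pi f f.
  rewrite /inner Rintegral_discr; apply: eq_bigr => x _.
  by rewrite m0 subr0 expr2.
have := H f; rewrite E => /(_ ff); congr (_ <= (_ / _)%:E)%E.
rewrite /inner Rintegral_discr; congr (- _); apply: eq_bigr => x _.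
by rewrite Mfg.
Qed.

Lemma gap_matrix_ge0 M : reversible_rates M -> (0 <= gap pi (matrix_op M))%E.
Proof.
move=> hM; apply: gap_matrix_ge => f _.
by rewrite lee_fin divr_ge0 ?variance_ge0 ?dirichlet_ge0.
Qed.

Lemma gap_matrix_variance M f (l : R) : reversible_rates M ->
  (l%:E <= gap pi (matrix_op M))%E -> l * variance f <= dirichlet M f.
Proof.
move=> hM lM; have [v0|v0] := eqVneq (variance f) 0.
  by rewrite v0 mulr0 dirichlet_ge0.
have vp : 0 < variance f by rewrite lt_def v0 variance_ge0.
by rewrite -ler_pdivlMr// -lee_fin (le_trans lM)// gap_matrix_le.
Qed.

Lemma cvgr_sum (I : Type) (r : seq I) (u : I -> nat -> R) (l : I -> R) :
  (forall i, u i n @[n --> \oo] --> l i) ->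
  \sum_(i <- r) u i n @[n --> \oo] --> \sum_(i <- r) l i.
Proof.
move=> ul; elim: r => [|i r IH].
  by rewrite big_nil; under eq_fun do rewrite big_nil; exact: cvg_cst.
by rewrite big_cons; under eq_fun do rewrite big_cons; exact: cvgD.
Qed.

Lemma mean_cvg (u : nat -> S -> R) f :
  (forall x, u n x @[n --> \oo] --> f x) -> mean (u n) @[n --> \oo] --> mean f.
Proof. by move=> uf; apply: cvgr_sum => x; apply: cvgMr; exact: uf. Qed.

Lemma variance_cvg (u : nat -> S -> R) f :
  (forall x, u n x @[n --> \oo] --> f x) ->
  variance (u n) @[n --> \oo] --> variance f.
Proof.
move=> uf; apply: cvgr_sum => x; apply: cvgMr.
have H : u n x - mean (u n) @[n --> \oo] --> f x - mean f.
  by apply: cvgB; [exact: uf|exact: mean_cvg].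
by rewrite expr2; under eq_fun do rewrite expr2; exact: cvgM.
Qed.

Lemma dirichlet_cvg M (u : nat -> S -> R) f :
  (forall x, u n x @[n --> \oo] --> f x) ->
  dirichlet M (u n) @[n --> \oo] --> dirichlet M f.
Proof.
move=> uf; apply: cvgN; apply: cvgr_sum => x; apply: cvgMr.
apply: cvgM; last exact: uf.
by apply: cvgr_sum => y; apply: cvgMr; exact: uf.
Qed.

Lemma rat_approx f : exists u : nat -> {ffun S -> rat},
  forall x, ratr (u n x) @[n --> \oo] --> f x.
Proof.
have H n x : exists q : rat, f x < ratr q < f x + n.+1%:R^-1.
  have [|q /[!in_itv]/= hq] := @rat_in_itvoo R (f x) (f x + n.+1%:R^-1).
    by rewrite ltrDl invr_gt0.
  by exists q.
pose u n := [ffun x => projT1 (cid (H n x))].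
exists u => x.
have fn : f x + n.+1%:R^-1 @[n --> \oo] --> f x.
  rewrite -[X in _ --> X]addr0; apply: cvgD; first exact: cvg_cst.
  exact: cvg_harmonic.
apply: (squeeze_cvgr _ (cvg_cst (f x)) fn).
apply: nearW => n; rewrite /u ffunE; case: cid => q /= /andP[h1 h2].
by rewrite !ltW.
Qed.

(* The Rayleigh quotient is continuous where the variance is nonzero, so that
   countably many test functions suffice. *)
Lemma measurable_gap_matrix (dT : measure_display) (T : measurableType dT)
    (M : T -> S -> S -> R) :
  (forall x y, measurable_fun setT (fun p => M p x y)) ->
  (forall p, reversible_rates (M p)) ->
  measurable_fun setT (fun p => gap pi (matrix_op (M p))).
Proof.
move=> mM hM.
pose q2f (q : {ffun S -> rat}) : S -> R := fun x => ratr (q x).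
(* The default [+oo] is neutral for the infimum: it discards codes that decode to nothing and test
   functions of zero variance. *)
pose F (n : nat) (p : T) : \bar R := if unpickle n is Some q then
  (if variance (q2f q) == 0 then +oo%E
   else (dirichlet (M p) (q2f q) / variance (q2f q))%:E) else +oo%E.
have -> : (fun p => gap pi (matrix_op (M p))) = (fun p => einfs (F ^~ p) 0%N).
  apply/funext => p; apply/eqP; rewrite eq_le; apply/andP; split.
    apply: le_ereal_inf_tmp => _ [n _ <-]; rewrite /F.
    case: unpickle => [q|]; last by rewrite leey.
    by case: ifPn => [_|v0]; [rewrite leey|exact: gap_matrix_le].
  apply: gap_matrix_ge => f v0; have [u uf] := rat_approx f.
  have vc := variance_cvg uf.
  have qc : (dirichlet (M p) (q2f (u n)) / variance (q2f (u n)))%:E @[n --> \oo]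
      --> (dirichlet (M p) f / variance f)%:E.
    apply: cvg_EFin; first exact: nearW.
    by apply: cvgM; [exact: dirichlet_cvg|exact: cvgV].
  apply: (cvge_ge _ qc).
  have vn : \forall n \near \oo, variance (q2f (u n)) != 0.
    exact: cvgr_neq0 vc v0.
  apply: filterS vn => n vn; apply: ereal_inf_lbound.
  by exists (pickle (u n)) => //=; rewrite /F pickleK (negbTE vn).
apply: measurable_fun_einfs => n; rewrite /F.
case: (unpickle n : option {ffun S -> rat}) => [q|]; last exact: measurable_cst.
have [_|_] := eqVneq (variance (q2f q)) 0; first exact: measurable_cst.
apply/measurable_EFinP; apply: measurable_funM => //.
apply: measurable_funN => //; apply: measurable_sum => x.
apply: measurable_funM => //; apply: measurable_funM => //.
by apply: measurable_sum => y; exact: measurable_funM.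
Qed.

End dirichlet_form.

(** * The symmetrised rates and their spectral gap *)

Section Qrev.
Variables (R : realType) (X : finType) (x0 : X) (d : nat).
Variables (pi : probability (discr x0) R) (rho : probability 'rV[R]_d R).
Local Notation S := (discr x0).
Local Notation wt := (wt pi).
Variable Q : 'rV[R]_d -> S -> S -> R.
Hypothesis Q_rate : rate_matrix pi rho Q.

(** Where [wt x = 0] the left side is 0 by convention, and the right side because no rate leads out
    of the support. *)
Lemma wt_Qadj p x y : wt x * Qadj pi Q p x y = wt y * Q p y x.
Proof.
rewrite /Qadj; have [x0'|x0'] := eqVneq (wt x) 0; last by field.
by rewrite (rate_supp Q_rate); [rewrite !mulr0|right].
Qed.

(** [qvec] is the row sum of [Qadj], so subtracting it on the diagonal restores zero row sums;
    detailed balance comes from averaging [Q] with its weighted transpose. *)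
Lemma Qrev_rates p : reversible_rates pi (Qrev pi Q p).
Proof.
split=> [x y|x|x y xy].
- rewrite /Qrev /Qdag (mulrCA (wt x)) (mulrCA (wt y)); congr (_ * _).
  have [->//|xy] := eqVneq x y.
  by rewrite !subr0 !mulrDr !wt_Qadj addrC.
- rewrite /Qrev -mulr_sumr big_split/=.
  have -> : \sum_y Q p x y = 0.
    by rewrite (bigD1 x)//= (rate_diag Q_rate) addrC subrr.
  rewrite add0r /Qdag sumrB -/(qvec pi Q x p).
  have -> : (\sum_y (if x == y then qvec pi Q x p else 0)) = qvec pi Q x p.
    rewrite (bigD1 x)//= eqxx big1 ?addr0// => y.
    by rewrite eq_sym => /negbTE ->.
  by rewrite subrr mulr0.
- rewrite /Qrev /Qdag (negbTE xy) subr0 mulr_ge0// addr_ge0//.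
    exact: rate_ge0 Q_rate _ _ _ xy.
  rewrite /Qadj; case: ifP => // _.
  by rewrite !mulr_ge0 ?invr_ge0 ?wt_ge0// (rate_ge0 Q_rate)// eq_sym.
Qed.

Lemma Qadj_L2 x y : L2 rho (fun p => Qadj pi Q p x y).
Proof.
rewrite /Qadj; have [_|_] := eqVneq (wt x) 0; first exact: L2_cst.
under [X in L2 rho X]eq_fun do rewrite -mulrA mulrC.
by apply: L2Z; exact: rate_L2 Q_rate _ _.
Qed.

Lemma Qrev_L2 x y : L2 rho (fun p => Qrev pi Q p x y).
Proof.
apply: L2Z; apply: L2D; first exact: rate_L2 Q_rate _ _.
apply: L2B; first exact: Qadj_L2.
have [_|_] := eqVneq x y; last exact: L2_cst.
by apply: L2_sum => z; exact: Qadj_L2.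
Qed.

Lemma measurable_lambda_x : measurable_fun setT (lambda_x pi Q).
Proof.
apply: measurable_gap_matrix => [x y|p]; last exact: Qrev_rates.
by apply: L2_measurable; exact: Qrev_L2.
Qed.

Lemma lambda_x_ge0 p : (0 <= lambda_x pi Q p)%E.
Proof. by apply: gap_matrix_ge0; exact: Qrev_rates. Qed.

End Qrev.

(** * The equation for lambda star *)

Section lambda_star.
Context (dT : measure_display) (T : measurableType dT) (R : realType).
Variables (rho : probability T R) (lam : T -> \bar R) (c : R).
Hypotheses (mlam : measurable_fun setT lam) (lam0 : forall p, (0 <= lam p)%E).
Hypothesis c0 : 0 < c.

Let G l p := (c%:E / (lam p + c%:E - l%:E))%E.

Lemma weight_pinfty l p : lam p = +oo%E -> G l p = 0%E.
Proof. by move=> lamp; rewrite /G lamp !addye// invey mule0. Qed.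

Lemma weight_fin (l r : R) p : lam p = r%:E -> 0 < r + c - l ->
  G l p = (c / (r + c - l))%:E.
Proof.
move=> lamp rcl; by rewrite /G lamp -EFinD inver gt_eqF.
Qed.

Lemma lam_cases p : lam p = +oo%E \/ exists2 r : R, lam p = r%:E & 0 <= r.
Proof.
have := lam0 p; case: (lam p) => [r| |]//; last by left.
by rewrite lee_fin => r0; right; exists r.
Qed.

(** The maximum with [c - l] never acts, since [lam p >= 0]; it makes the formula continuous in
    [fine (lam p)] on the whole line, whence measurability, and gives the bound [c / (c - l)]. *)
Lemma weightE (l : R) p : l < c -> G l p =
  ((if lam p == +oo%E then 0 else c / Num.max (fine (lam p) + c - l) (c - l))%:E).
Proof.
move=> lc; have [lamp|[r lamp r0]] := lam_cases p.
  by rewrite weight_pinfty// lamp eqxx.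
rewrite (@weight_fin l r)//; last by lra.
by rewrite lamp/= max_l//; lra.
Qed.

Lemma weight_ge0 (l : R) p : l <= c -> (0 <= G l p)%E.
Proof.
move=> lc; rewrite /G mule_ge0 ?lee_fin ?(ltW c0)// inve_ge0.
have [lamp|[r lamp r0]] := lam_cases p; first by rewrite lamp !addye// leey.
by rewrite lamp lee_fin; lra.
Qed.

Lemma weight_bound (l : R) p : l < c -> (G l p <= (c / (c - l))%:E)%E.
Proof.
move=> lc; have cl : 0 < c - l by lra.
rewrite weightE// lee_fin; case: ifP => _; first by rewrite divr_ge0 ?ltW.
have mx : c - l <= Num.max (fine (lam p) + c - l) (c - l) by rewrite le_max lexx orbT.
by rewrite ler_pM2l// lef_pV2// posrE// (lt_le_trans cl).
Qed.

Lemma measurable_weight_lt (l : R) : l < c -> measurable_fun setT (G l).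
Proof.
move=> lc; have cl : 0 < c - l by lra.
have -> : G l = EFin \o (fun p => if lam p == +oo%E then 0 else
    c * (Num.max (fine (lam p) + c - l) (c - l))^-1).
  by apply/funext => p; exact: weightE.
apply/measurable_EFinP; apply: measurable_fun_ifT => //.
  exact: measurable_fun_eqe.
apply: measurable_funM => //.
have cinv : continuous (fun y : R => (Num.max y (c - l))^-1).
  move=> y; apply: cvgV.
    by rewrite gt_eqF// lt_max cl orbT.
  by apply: (@continuous_max R R id (cst (c - l)) y) => //; exact: cvg_cst.
apply: (measurableT_comp (f := fun y : R => (Num.max y (c - l))^-1)).
  exact: continuous_measurable_fun.
apply: measurable_funB => //; apply: measurable_funD => //.
exact: measurableT_comp.
Qed.

(** Levels increasing from 0 to [c]. Below [c] the weight is bounded; at [c] it is infinite where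
    [lam] vanishes, so statements about level [c] are reached as limits along [ln]. *)
Let ln n : R := c - c / n.+1%:R.

Let ln_lt n : ln n < c.
Proof. by rewrite /ln ltrBlDr ltrDl divr_gt0. Qed.

Let ln_ge0 n : 0 <= ln n.
Proof.
rewrite /ln subr_ge0 ler_pdivrMr//; apply: ler_peMr; first exact: ltW.
by rewrite ler1n.
Qed.

Lemma weight_nondecreasing (l l' : R) p : l <= l' -> l' < c ->
  (G l p <= G l' p)%E.
Proof.
move=> ll' lc; have [lamp|[r lamp r0]] := lam_cases p.
  by rewrite !weight_pinfty.
rewrite !(@weight_fin _ r)//; [|lra..].
by rewrite lee_fin ler_pM2l// lef_pV2// ?posrE; lra.
Qed.

Lemma weight_cvg p : G (ln n) p @[n --> \oo] --> G c p.
Proof.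
have [lamp|[r lamp r0]] := lam_cases p.
  rewrite weight_pinfty//; under eq_fun do rewrite weight_pinfty//.
  exact: cvg_cst.
have h0 : c / n.+1%:R @[n --> \oo] --> 0.
  by rewrite -(mulr0 c); apply: cvgMr; exact: cvg_harmonic.
have E n : G (ln n) p = (c / (r + c / n.+1%:R))%:E.
  have cn : 0 < c / n.+1%:R by rewrite divr_gt0.
  rewrite /ln; set e := c / _ in cn *.
  by rewrite (@weight_fin _ r)//; [congr (_ / _)%:E; ring|lra].
under eq_fun do rewrite E.
(* For [lam p = 0] the weight at level [ln n] is exactly [n + 1], in agreement with
   [c / 0 = +oo]. *)
have [r00|rn0] := eqVneq r 0.
  have -> : G c p = +oo%E.
    rewrite /G lamp r00 add0e subee// inve0 gt0_muley// lte_fin//.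
  apply/cvgeryP; apply/cvgryPge => A; near=> n.
  rewrite r00 add0r invf_div mulrCA divff ?gt_eqF// mulr1.
  near: n; exists (Num.trunc A).+1 => // n /= An.
  apply: le_trans (ltW (truncnS_gt _)) _.
  by rewrite ler_nat (leq_trans An).
have rp : 0 < r by rewrite lt_def rn0.
rewrite (@weight_fin _ r)//; last by lra.
rewrite addrK; apply: cvg_EFin; first exact: nearW.
apply: cvgMr; apply: cvgV => //.
by rewrite -[X in _ --> X]addr0; apply: cvgD => //; exact: cvg_cst.
Unshelve. all: by end_near. Qed.

Lemma measurable_weight (l : R) : l <= c -> measurable_fun setT (G l).
Proof.
rewrite le_eqVlt => /orP[/eqP ->|]; last exact: measurable_weight_lt.
apply: (@emeasurable_fun_cvg _ _ _ _ (fun n => G (ln n))).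
  by move=> n; exact: measurable_weight_lt.
by move=> p _; exact: weight_cvg.
Qed.

(** The integral that separates the two cases of lambda star is the left side of the equation at the
    endpoint [l = c]. *)
Lemma weight_cE p : G c p = if lam p == 0%E then +oo%E else (c%:E / lam p)%E.
Proof.
rewrite /G addeK//; case: ifP => // /eqP ->.
by rewrite inve0 gt0_muley// lte_fin.
Qed.

(** Freezing the level at [l0 < c] keeps the weight away from its singularity and makes [h l0]
    Lipschitz on the whole line, ready for the intermediate value theorem. *)
Let h (l0 l : R) := \int[rho]_p fine (G (Num.min l l0) p).

Let integrable_weight (l : R) : l < c ->
  rho.-integrable setT (fun p => (fine (G l p))%:E).
Proof.
move=> lc; apply: (@integrable_bounded _ _ _ _ _ (c / (c - l))).
  by apply: (measurableT_comp (f := fine)) => //; exact: measurable_weight_lt.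
move=> p; have b := weight_bound p lc; have b0 := weight_ge0 p (ltW lc).
by rewrite ger0_norm ?fine_ge0// -lee_fin fineK// weightE.
Qed.

Let hE l0 l : l0 < c -> l <= l0 -> (h l0 l)%:E = (\int[rho]_p G l p)%E.
Proof.
move=> l0c ll0; have lc : l < c by lra.
rewrite /h min_l// /Rintegral fineK; last exact: integrable_fin_num (integrable_weight lc).
by apply: eq_integral => p _; rewrite fineK// weightE.
Qed.

(** The constant bounds the derivative [c / (r + c - l) ^+ 2] of the weight in [l], for [r >= 0] and
    [l <= l0]. *)
Let h_lip l0 : l0 < c -> forall l l',
  `|h l0 l - h l0 l'| <= c / (c - l0) ^+ 2 * `|l - l'|.
Proof.
move=> l0c l l'; have cl : 0 < c - l0 by lra.
have ml y : Num.min y l0 <= l0 by rewrite ge_min lexx orbT.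
have mlc y : Num.min y l0 < c by exact: le_lt_trans (ml y) l0c.
have i1 := integrable_weight (mlc l); have i2 := integrable_weight (mlc l').
rewrite /h -RintegralB//.
apply: le_trans (le_normr_Rintegral measurableT (integrable_subr i1 i2)) _.
rewrite -[leRHS](Rintegral_cst1 rho); apply: le_Rintegral => //.
- by apply: integrable_norm; exact: integrable_subr.
- exact: integrable_cstr.
move=> p _; have [lamp|[r lamp r0]] := lam_cases p.
  rewrite !weight_pinfty// subrr normr0 mulr_ge0//.
  by rewrite divr_ge0 ?sqr_ge0 ?ltW.
have a1 := ml l; have a2 := ml l'.
rewrite !(@weight_fin _ r)//=; [|lra..].
set m := Num.min l l0 in a1 *; set m' := Num.min l' l0 in a2 *.
have -> : c / (r + c - m) - c / (r + c - m') =
    c / ((r + c - m) * (r + c - m')) * (m - m').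
  by field; apply/andP; split; rewrite gt_eqF//; lra.
rewrite normrM; apply: ler_pM => //.
- have p1 : 0 < r + c - m by lra.
  have p2 : 0 < r + c - m' by lra.
  have p3 : 0 < (r + c - m) * (r + c - m') by exact: mulr_gt0.
  rewrite gtr0_norm ?divr_gt0// ler_pM2l// lef_pV2// ?posrE//; last exact: exprn_gt0.
  by rewrite expr2; apply: ler_pM; lra.
- rewrite /m /m'; have [ll|ll] := leP l l0; have [ll'|ll'] := leP l' l0.
  + by [].
  + rewrite ler_norml; apply/andP; split.
      by have := ler_norm (l' - l); rewrite distrC; lra.
    by have := normr_ge0 (l - l'); lra.
  + rewrite ler_norml; apply/andP; split.
      by have := normr_ge0 (l - l'); lra.
    by have := ler_norm (l - l'); lra.
  + by rewrite subrr normr0.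
Qed.

Let h_continuous l0 : l0 < c -> continuous (h l0).
Proof.
move=> l0c l; apply/cvgrPdist_lt => e e0.
have cl : 0 < c - l0 by lra.
pose C := c / (c - l0) ^+ 2.
have C0 : 0 < C by rewrite divr_gt0// exprn_gt0.
near=> y; apply: le_lt_trans (h_lip l0c _ _) _.
rewrite -/C mulrC -ltr_pdivlMr//; near: y.
by apply/nbhs_ballP; exists (e / C); [exact: divr_gt0|move=> z].
Unshelve. all: by end_near. Qed.

(** By monotone convergence the integral already exceeds 1 at some level [ln n < c]. At level 0 the
    weight is at most 1, hence so is its integral, and the intermediate value theorem applies in
    between. *)
Lemma exists_lambda_star :
  (1 < \int[rho]_p (if lam p == 0 then +oo else c%:E / lam p))%E ->
  exists2 l, 0 <= l <= c & (\int[rho]_p (c%:E / (lam p + c%:E - l%:E)) = 1)%E.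
Proof.
move=> gt1.
have Gc : (\int[rho]_p (if lam p == 0 then +oo else c%:E / lam p) =
    \int[rho]_p G c p)%E by apply: eq_integral => p _; rewrite weight_cE.
rewrite {}Gc in gt1.
have cvg : (\int[rho]_p G (ln n) p @[n --> \oo] --> \int[rho]_p G c p)%E.
  apply: ge0_integral_cvg.
  - by move=> n; exact: measurable_weight_lt.
  - by move=> n p; apply: weight_ge0; exact: ltW.
  - move=> p m n mn; apply: weight_nondecreasing => //.
    by rewrite /ln lerD2l lerN2 ler_pM2l// lef_pV2// ?posrE// ler_nat.
  - by move=> p; exact: weight_cvg.
have [n n1] : exists n, (1 < \int[rho]_p G (ln n) p)%E.
  apply: contrapT => /forallNP H.
  have : (\int[rho]_p G c p <= 1)%E.
    by apply: (cvge_le _ cvg); apply: nearW => n; rewrite leNgt; exact/negP.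
  by rewrite leNgt gt1.
have l0c := ln_lt n; have l00 := ln_ge0 n; set l0 := ln n in n1 l0c l00.
have h1 : 1 <= h l0 l0 by rewrite -lee_fin hE// ltW.
have h0 : h l0 0 <= 1.
  rewrite /h min_l// -[leRHS](Rintegral_cst1 rho); apply: le_Rintegral => //.
  - exact: integrable_weight.
  - exact: integrable_cstr.
  - move=> p _; rewrite -lee_fin fineK ?weightE// -weightE//.
    by have := weight_bound p c0; rewrite subr0 divff// gt_eqF.
have [l lI hl] : exists2 l, l \in `[0, l0] & h l0 l = 1.
  apply: IVT => //.
  - by apply: continuous_subspaceT; exact: h_continuous.
  - by rewrite ge_min h0/= le_max h1 orbT.
move: lI; rewrite in_itv/= => /andP[l0' ll0].
exists l; first by rewrite l0'/=; lra.
by rewrite -hl hE.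
Qed.

End lambda_star.

(** * The lower bound *)

Section poincare.
Context (dT : measure_display) (T : measurableType dT) (R : realType).
Variables (rho : probability T R) (X : finType) (x0 : X).
Variable pi : probability (discr x0) R.
Local Notation S := (discr x0).
Local Notation wt := (wt pi).
Local Notation ing f := (rho.-integrable setT (EFin \o f)).

Lemma ae_le_Rintegral (f g : T -> R) : ing f -> ing g ->
  {ae rho, forall x, f x <= g x} -> \int[rho]_x f x <= \int[rho]_x g x.
Proof.
move=> hf hg fg; rewrite -subr_ge0 -RintegralB//.
have mgf : measurable_fun setT (fun x => g x - f x).
  by apply/measurable_EFinP; exact: measurable_int (integrable_subr hg hf).
rewrite (@ae_eq_Rintegral _ _ _ _ _ (fun x => Num.max (g x - f x) 0))//.
- by apply: Rintegral_ge0 => x _; rewrite le_max lexx orbT.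
- exact: measurable_maxr.
- by apply: filterS fg => x fgx; rewrite max_l// subr_ge0.
Qed.

Lemma variance0_wt (f : S -> R) : variance pi f = 0 ->
  forall x, wt x * (f x - mean pi f) = 0.
Proof.
move=> /eqP; rewrite /variance psumr_eq0.
  move=> /allP H x; have := H x (mem_index_enum _); rewrite implyTb mulf_eq0.
  by move=> /orP[/eqP ->|/eqP/eqP]; rewrite ?mul0r// sqrf_eq0 => /eqP ->; rewrite mulr0.
by move=> x _; rewrite mulr_ge0 ?wt_ge0 ?sqr_ge0.
Qed.

Lemma varianceE (f : S -> R) :
  variance pi f = \sum_x wt x * f x ^+ 2 - mean pi f ^+ 2.
Proof.
have H m : \sum_x wt x * (f x - m) ^+ 2 =
    \sum_x wt x * f x ^+ 2 - (2 * m) * (\sum_x wt x * f x) + m ^+ 2 * \sum_x wt x.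
  by rewrite !mulr_sumr -sumrB -big_split/=; apply: eq_bigr => x _; ring.
by rewrite /variance H sum_wt -/(mean pi f); ring.
Qed.

Variables (M : T -> S -> S -> R) (c l : R).
Hypothesis mM : forall x y, measurable_fun setT (fun p => M p x y).
Hypothesis hM : forall p, reversible_rates pi (M p).
Hypotheses (c0 : 0 < c) (lc : l <= c).
Let lam p := gap pi (matrix_op (M p)).
Let G p := (c%:E / (lam p + c%:E - l%:E))%E.
(** The inequality covers both cases of lambda star: equality when the equation is solved, and
    [l = c] with an integral at most 1 otherwise. *)
Hypothesis G1 : (\int[rho]_p G p <= 1)%E.

Let lam0 p : (0 <= lam p)%E.
Proof. exact: gap_matrix_ge0. Qed.

Let mlam : measurable_fun setT lam.
Proof. exact: measurable_gap_matrix. Qed.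

Let G0 p : (0 <= G p)%E.
Proof. exact: weight_ge0. Qed.

Let mG : measurable_fun setT G.
Proof. exact: (measurable_weight mlam). Qed.

Let integrableG : rho.-integrable setT G.
Proof.
apply/integrableP; split=> //.
under eq_integral do rewrite gee0_abs//.
by apply: le_lt_trans G1 _; rewrite ltry.
Qed.

(** A real version of the weight. For [l = c] the weight is infinite where [lam] vanishes; [G1]
    makes that a null set, and there [fine] returns 0. *)
Let k p := fine (G p).

Let fineG_le p : ((k p)%:E <= G p)%E.
Proof. by have := G0 p; rewrite /k; case: (G p) => [r| |]//=; rewrite ?leey. Qed.

Let mk : measurable_fun setT k.
Proof. exact: measurableT_comp. Qed.

Let mEk : measurable_fun setT (fun p => (k p)%:E).
Proof. exact/measurable_EFinP. Qed.

Let k0 p : 0 <= k p.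
Proof. exact: fine_ge0. Qed.

Let int_k : (\int[rho]_p (k p)%:E <= 1)%E.
Proof.
apply: le_trans G1; apply: ge0_le_integral => // p _.
by rewrite lee_fin.
Qed.

Let integrable_k : ing k.
Proof.
apply/integrableP; split=> //.
under eq_integral do rewrite /= ger0_norm//.
by apply: le_lt_trans int_k _; rewrite ltry.
Qed.

Let Rint_k : \int[rho]_p k p <= 1.
Proof.
by rewrite -lee_fin /Rintegral fineK//; exact: integrable_fin_num integrable_k.
Qed.

(* AM-GM: [2 c m w <= r w^2 + c^2 m^2 / r] with [r = lam p + c - l]. *)
Let pointwise p (f m : S -> R) : G p \is a fin_num ->
  \sum_x wt x * (2 * c * m x * (f x - mean pi f)) <=
  dirichlet pi (M p) f + (c - l) * variance pi f
  + c * k p * \sum_x wt x * m x ^+ 2.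
Proof.
move=> Gfin; have [lamp|[r lamp r0]] := lam_cases lam0 p.
  have V0 : variance pi f = 0.
    apply/eqP/negPn/negP => V0; have := gap_matrix_le (hM p) V0.
    by rewrite -/(lam p) lamp.
  have K0 : k p = 0 by rewrite /k /G weight_pinfty.
  rewrite V0 K0 !mulr0 mul0r !addr0 big1 ?dirichlet_ge0// => x _.
  by rewrite mulrCA variance0_wt// mulr0.
(* Since [r >= 0] and [l <= c], the sum can fail to be positive only by being 0, and then [G p]
   would be infinite. *)
have rc : 0 < r + c - l.
  have [//|rc] := ltP 0 (r + c - l).
  have E : r + c - l = 0.
    by apply/eqP; rewrite eq_le rc -addrA addr_ge0// subr_ge0.
  by move: Gfin; rewrite /G lamp -EFinD E inve0 gt0_muley// lte_fin.
have kE : k p = c / (r + c - l) by rewrite /k /G (weight_fin lamp rc).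
have D := @gap_matrix_variance _ _ _ pi (M p) f r (hM p).
rewrite -/(lam p) lamp in D; have {}D := D (lexx _).
apply: (@le_trans _ _ ((r + c - l) * variance pi f +
    c * k p * \sum_x wt x * m x ^+ 2)); last by lra.
rewrite /variance !mulr_sumr -big_split/=; apply: ler_sum => x _.
set w := f x - mean pi f; set n := r + c - l in rc kE *.
have -> : n * (wt x * w ^+ 2) + c * k p * (wt x * m x ^+ 2) =
    wt x * (n * w ^+ 2 + c * k p * m x ^+ 2) by ring.
apply: ler_wpM2l; first exact: wt_ge0.
have : 0 <= (n * w - c * m x) ^+ 2 / n by rewrite divr_ge0 ?sqr_ge0 ?ltW.
have -> : (n * w - c * m x) ^+ 2 / n =
    n * w ^+ 2 + c * k p * m x ^+ 2 - 2 * c * m x * w.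
  by rewrite kE; field; rewrite gt_eqF.
by rewrite subr_ge0.
Qed.

(** Integrate [pointwise] with [m x] the mean of [w x]: the left side gives [2 c m2], the weight
    term at most [c m2]. The variance in [p] of the average [ub] enters with the factor [c - l >= 0]
    and is discarded by Jensen. *)
Lemma poincare_product (u : S -> T -> R) : (forall x, L2 rho (u x)) ->
  ing (fun p => dirichlet pi (M p) (u ^~ p)) ->
  l * (\sum_x wt x * \int[rho]_p u x p ^+ 2 -
       (\sum_x wt x * \int[rho]_p u x p) ^+ 2) <=
  \int[rho]_p dirichlet pi (M p) (u ^~ p) +
  c * \sum_x wt x * (\int[rho]_p u x p ^+ 2 - (\int[rho]_p u x p) ^+ 2).
Proof.
move=> hu hD.
pose a x := \int[rho]_p u x p; pose ub p := mean pi (u ^~ p).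
have hub : L2 rho ub by apply: L2_sum => x; exact: L2Z.
pose b := \int[rho]_p ub p.
have bE : b = \sum_x wt x * a x.
  rewrite /b /ub /mean Rintegral_sum; last first.
    by move=> x; apply: integrable_scaler; exact: L2_integrable.
  by apply: eq_bigr => x _; rewrite RintegralZl//; exact: L2_integrable.
pose m x := a x - b; pose w x p := u x p - ub p.
have hw x : L2 rho (w x) by exact: L2B.
have mE x : \int[rho]_p w x p = m x.
  by rewrite /w RintegralB//; exact: L2_integrable.
have u2 x : ing (fun p => u x p ^+ 2) by have [] := (L2P rho (u x)).1 (hu x).
have ub2 : ing (fun p => ub p ^+ 2) by have [] := (L2P rho ub).1 hub.
pose V p := variance pi (u ^~ p).
have VE : V = fun p => \sum_x wt x * u x p ^+ 2 - ub p ^+ 2.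
  by apply/funext => p; exact: varianceE.
have hs : ing (fun p => \sum_x wt x * u x p ^+ 2).
  by apply: integrable_sumr => x; exact: integrable_scaler.
have hV : ing V by rewrite VE; exact: integrable_subr.
have IV : \int[rho]_p V p = \sum_x wt x * (\int[rho]_p u x p ^+ 2)
    - \int[rho]_p ub p ^+ 2.
  rewrite VE RintegralB// Rintegral_sum; last by move=> x; exact: integrable_scaler.
  by congr (_ - _); apply: eq_bigr => x _; rewrite RintegralZl.
pose m2 := \sum_x wt x * m x ^+ 2.
have m20 : 0 <= m2 by apply: sumr_ge0 => x _; rewrite mulr_ge0 ?wt_ge0 ?sqr_ge0.
have m2E : m2 = \sum_x wt x * a x ^+ 2 - b ^+ 2.
  have := varianceE a; rewrite /mean -bE => <-.
  by apply: eq_bigr => x _; rewrite /mean -bE.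
have hL : ing (fun p => \sum_x wt x * (2 * c * m x * w x p)).
  apply: integrable_sumr => x; apply: integrable_scaler; apply: integrable_scaler.
  exact: L2_integrable.
have IL : \int[rho]_p (\sum_x wt x * (2 * c * m x * w x p)) = 2 * c * m2.
  rewrite Rintegral_sum; last first.
    move=> x; apply: integrable_scaler; apply: integrable_scaler.
    exact: L2_integrable.
  rewrite mulr_sumr; apply: eq_bigr => x _.
  have hwx := L2_integrable (hw x).
  rewrite RintegralZl//; last exact: integrable_scaler.
  by rewrite RintegralZl// mE; ring.
have hV' := integrable_scaler (c - l) hV.
have hk' := integrable_scaler (c * m2) integrable_k.
have H : 2 * c * m2 <= \int[rho]_p dirichlet pi (M p) (u ^~ p) +
    (c - l) * \int[rho]_p V p + (c * m2) * \int[rho]_p k p.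
  rewrite -IL -!RintegralZl// -RintegralD// -RintegralD//; last exact: integrable_addr.
  apply: ae_le_Rintegral => //.
    by apply: integrable_addr => //; exact: integrable_addr.
  apply: filterS (integrable_ae measurableT integrableG) => p /(_ Logic.I) Gfin.
  by have := pointwise (u ^~ p) m Gfin; rewrite -/m2 [c * k p * m2]mulrAC.
have Hk : (c * m2) * \int[rho]_p k p <= c * m2.
  by rewrite ler_piMr// mulr_ge0// ltW.
have Hb : (c - l) * b ^+ 2 <= (c - l) * \int[rho]_p ub p ^+ 2.
  by rewrite ler_wpM2l ?subr_ge0//; exact: sqr_Rintegral_le.
have -> : \sum_x wt x * (\int[rho]_p u x p ^+ 2 - (\int[rho]_p u x p) ^+ 2) =
    \sum_x wt x * (\int[rho]_p u x p ^+ 2) - \sum_x wt x * a x ^+ 2.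
  by rewrite -sumrB; apply: eq_bigr => x _; rewrite mulrBr.
rewrite -bE; rewrite IV m2E in H; rewrite m2E in Hk.
move: H Hk Hb.
set U2 := \sum_x wt x * (\int[rho]_p u x p ^+ 2).
set A2 := \sum_x wt x * a x ^+ 2.
set B2 := \int[rho]_p ub p ^+ 2.
set D := \int[rho]_p dirichlet _ _ _.
set K := _ * \int[rho]_p k p.
move=> H Hk Hb; lra.
Qed.

End poincare.

(** * Self-adjoint operators and their cores *)

Section self_adjoint.
Context (dT : measure_display) (T : measurableType dT) (R : realType).
Variables (nu : probability T R) (A : L2op R T).
Hypothesis A_sa : self_adjoint nu A.

Lemma self_adjoint_L2 f g : A f g -> L2 nu f /\ L2 nu g.
Proof. by have [H _ _] := A_sa; exact: H. Qed.

Lemma self_adjoint_sym f g u v : A f g -> A u v -> inner nu f v = inner nu g u.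
Proof.
move=> Afg; have [hf hg] := self_adjoint_L2 Afg.
by have [_ _ H] := A_sa; have /(H _ _ hf hg) := Afg; apply.
Qed.

(** Operators are relations between representatives, so images are unique only up to null sets; the
    weak form stated here follows from density of the domain. It lets an abstract image of a core
    function be replaced by the explicit formula. *)
Lemma self_adjoint_unique u v v' f : A u v -> A u v' -> L2 nu f ->
  inner nu f v = inner nu f v'.
Proof.
move=> Av Av' hf; have [_ hv] := self_adjoint_L2 Av.
have [_ hv'] := self_adjoint_L2 Av'.
have [_ dense _] := A_sa; have [w wdom wf] := dense f hf.
have hw n : L2 nu (w n) by have [z /self_adjoint_L2[]] := wdom n.
have H : inner nu (w n) v @[n --> \oo] --> inner nu f v.
  by apply: inner_cvg => //; exact: L2cvg_cst.
have H' : inner nu (w n) v' @[n --> \oo] --> inner nu f v'.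
  by apply: inner_cvg => //; exact: L2cvg_cst.
have E : (fun n => inner nu (w n) v) = (fun n => inner nu (w n) v').
  apply/funext => n; have [z Awz] := wdom n.
  by rewrite (self_adjoint_sym Awz Av) (self_adjoint_sym Awz Av').
by rewrite E in H; exact: cvg_unique H H'.
Qed.

(** A self-adjoint operator equals its adjoint, so membership in the graph is a weak identity;
    approximation of both components by the core transfers that identity to the whole domain. *)
Lemma self_adjoint_core C f g : is_core nu A C -> L2 nu f -> L2 nu g ->
  (forall u v, C u -> A u v -> inner nu f v = inner nu g u) -> A f g.
Proof.
move=> [_ core] hf hg H; have [_ _ sa] := A_sa; apply/(sa _ _ hf hg) => u v Auv.
have [hu hv] := self_adjoint_L2 Auv.
have [un [vn [Cu Aun uc vc]]] := core _ _ Auv.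
have hun n : L2 nu (un n) by have [] := self_adjoint_L2 (Aun n).
have hvn n : L2 nu (vn n) by have [] := self_adjoint_L2 (Aun n).
have H1 : inner nu f (vn n) @[n --> \oo] --> inner nu f v.
  by apply: inner_cvg => //; exact: L2cvg_cst.
have H2 : inner nu g (un n) @[n --> \oo] --> inner nu g u.
  by apply: inner_cvg => //; exact: L2cvg_cst.
have E : (fun n => inner nu f (vn n)) = (fun n => inner nu g (un n)).
  by apply/funext => n; exact: H.
by rewrite E in H1; exact: cvg_unique H1 H2.
Qed.

(** Core approximants of a centred function need not be centred. The hypothesis therefore bounds the
    variance, and the means disappear in the limit. *)
Lemma core_variance_bound C (l : R) : is_core nu A C ->
  (forall u v, C u -> A u v ->
    l * (inner nu u u - (\int[nu]_x u x) ^+ 2) <= - inner nu v u) ->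
  (l%:E <= gap nu A)%E.
Proof.
move=> [_ core] H; apply: le_ereal_inf_tmp => _ [f [g [Afg ff0 f0 ->]]].
have [hf hg] := self_adjoint_L2 Afg.
have [un [vn [Cu Aun uc vc]]] := core _ _ Afg.
have hun n : L2 nu (un n) by have [] := self_adjoint_L2 (Aun n).
have hvn n : L2 nu (vn n) by have [] := self_adjoint_L2 (Aun n).
have H1 : inner nu (vn n) (un n) @[n --> \oo] --> inner nu g f.
  exact: inner_cvg.
have H2 : inner nu (un n) (un n) @[n --> \oo] --> inner nu f f.
  exact: inner_cvg.
have H3 : \int[nu]_x un n x @[n --> \oo] --> 0.
  rewrite -f0 -inner1; under eq_fun do rewrite -inner1.
  by apply: inner_cvg => //; [move=> n; exact: L2_cst|exact: L2_cst|exact: L2cvg_cst].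
have H4 : l * (inner nu (un n) (un n) - (\int[nu]_x un n x) * (\int[nu]_x un n x))
    @[n --> \oo] --> l * (inner nu f f - 0 * 0).
  by apply: cvgMr; apply: cvgB => //; exact: cvgM.
have H5 : - inner nu (vn n) (un n) @[n --> \oo] --> - inner nu g f by exact: cvgN.
have ffp : 0 < inner nu f f.
  by rewrite lt_def ff0 Rintegral_ge0// => x _; rewrite -expr2 sqr_ge0.
rewrite lee_fin ler_pdivlMr//.
have := ler_cvg_to H4 H5; rewrite mul0r subr0; apply.
by apply: nearW => n; rewrite -expr2; exact: H.
Qed.

End self_adjoint.

Lemma Cc_infty_bounded (R : realType) (d : nat) (f : 'rV[R]_d -> R) :
  Cc_infty f -> exists M, forall p, `|f p| <= M.
Proof.
move=> [/(_ [::])[/= cf _] K].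
have /compact_bounded[M [_ HM]] : compact (f @` closure [set p | f p != 0]).
  by apply: continuous_compact => //; exact: continuous_subspaceT.
exists (`|M| + 1) => p; have [fp0|fp0] := eqVneq (f p) 0.
  by rewrite fp0 normr0 addr_ge0.
apply: (HM (`|M| + 1)).
  by apply: le_lt_trans (ler_norm M) _; rewrite ltrDl.
by exists p => //; exact: subset_closure.
Qed.

Section rates_sym.
Variables (R : realType) (X : finType) (x0 : X) (pi : probability (discr x0) R).
Local Notation wt := (wt pi).

Lemma rates_sym (M : discr x0 -> discr x0 -> R) (f g : discr x0 -> R) :
  reversible_rates pi M ->
  \sum_x wt x * (f x * \sum_y M x y * g y) =
  \sum_x wt x * ((\sum_y M x y * f y) * g x).
Proof.
move=> [sym _ _].
under eq_bigr do rewrite !mulr_sumr.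
under [RHS]eq_bigr do rewrite mulr_suml mulr_sumr.
rewrite exchange_big/=; apply: eq_bigr => x _; apply: eq_bigr => y _.
have -> : wt y * (f y * (M y x * g x)) = (wt y * M y x) * (f y * g x) by ring.
by rewrite (sym y x); ring.
Qed.

End rates_sym.

(** * Test functions and Poincaré inequality for [Lrev] *)

Section reversible_part.
Variables (R : realType) (X : finType) (x0 : X) (d : nat).
Variables (pi : probability (discr x0) R) (rho : probability 'rV[R]_d R).
Local Notation S := (discr x0).
Local Notation wt := (wt pi).
Local Notation nu := (pihat pi rho).
Local Notation ing f := (rho.-integrable setT (EFin \o f)).
Variable Q : 'rV[R]_d -> S -> S -> R.
Hypothesis Q_rate : rate_matrix pi rho Q.
Variables (gamma : R) (PD : R -> R.-pker 'rV[R]_d ~> 'rV[R]_d).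
Hypothesis PD_reversible : reversible rho PD.
Let LD := generator rho PD.
Hypothesis LD_Cc : forall f : 'rV[R]_d -> R, Cc_infty f -> dom LD f.
Variable Lrev : L2op R (S * 'rV[R]_d)%type.
Hypothesis Lrev_self_adjoint : self_adjoint nu Lrev.
Hypothesis Lrev_Cc : acts_on_Cc pi rho LD Lrev (Lrev_formula pi Q gamma).
Hypothesis Lrev_core : is_core nu Lrev (@Cc_infty_prod R X x0 d).
Local Notation Qr := (Qrev pi Q).

Let Cc_L2 (h : 'rV[R]_d -> R) : Cc_infty h -> L2 rho h.
Proof. by move=> /LD_Cc[g []]. Qed.

Let jump (u : S * 'rV[R]_d -> R) x p := \sum_y Qr p x y * u (y, p).

Let jump_L2 u x : Cc_infty_prod u -> L2 rho (jump u x).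
Proof.
move=> Cu; apply: L2_sum => y; have [M uM] := Cc_infty_bounded (Cu y).
under [X in L2 rho X]eq_fun do rewrite mulrC.
by apply: L2_bddM uM _; [apply: L2_measurable; exact: Cc_L2|exact: Qrev_L2].
Qed.

(** The common source of both bounds. [jump u] is in [L2] because [u] is bounded, whereas the rates
    applied to [f] need not be; so the rates pass from [u] to [f] by detailed balance at fixed [p],
    inside the integral. *)
Lemma Lrev_pairing u v (f : S * 'rV[R]_d -> R) : Cc_infty_prod u -> Lrev u v ->
  (forall x, L2 rho (fun p => f (x, p))) ->
  exists2 G : S -> 'rV[R]_d -> R, (forall x, LD (fun p => u (x, p)) (G x)) &
    inner nu f v =
    \int[rho]_p (\sum_x wt x * ((\sum_y Qr p x y * f (y, p)) * u (x, p))) +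
    gamma * \sum_x wt x * inner rho (fun p => f (x, p)) (G x).
Proof.
move=> Cu Luv hf.
have [G HG] := @choice _ _ (fun x g => LD (fun p => u (x, p)) g)
  (fun x => LD_Cc (Cu x)).
exists G => //.
have hG x : L2 rho (G x) by have [] := HG x.
have hu x : L2 rho (fun p => u (x, p)) by exact: Cc_L2.
have hI : id_tensor pi rho LD u (fun z => G z.1 z.2).
  split; [exact: L2_sections|exact: L2_sections|].
  by apply: nearW => x; exact: HG.
have Lform := Lrev_Cc Cu hI.
rewrite (self_adjoint_unique Lrev_self_adjoint Luv Lform); last exact: L2_sections.
have hj x := jump_L2 x Cu; have hgG x := L2Z gamma (hG x).
have hF x : L2 rho (fun p => Lrev_formula pi Q gamma u (fun z => G z.1 z.2) (x, p)).
  exact: (L2D (hj x) (hgG x)).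
rewrite inner_sections//.
have E x : inner rho (fun p => f (x, p))
    (fun p => Lrev_formula pi Q gamma u (fun z => G z.1 z.2) (x, p)) =
    inner rho (fun p => f (x, p)) (jump u x) +
    gamma * inner rho (fun p => f (x, p)) (G x).
  rewrite innerC; transitivity (inner rho (fun p => jump u x p + gamma * G x p)
    (fun p => f (x, p))) => //.
  by rewrite innerDl// innerZl// innerC [inner rho (G x) _]innerC.
under eq_bigr do rewrite E mulrDr mulrCA.
rewrite big_split/= -mulr_sumr; congr (_ + _).
have hfj x := L2M_integrable (hf x) (hj x).
transitivity (\int[rho]_p \sum_x wt x * (f (x, p) * jump u x p)).
  rewrite Rintegral_sum; last by move=> x; exact: integrable_scaler.
  by apply: eq_bigr => x _; rewrite RintegralZl.
apply: eq_Rintegral => p _.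
exact: (rates_sym (fun x => f (x, p)) (fun x => u (x, p)) (Qrev_rates Q_rate p)).
Qed.

(** The jump part sees a function constant in [x] and vanishes by the row sums. On each fibre
    [generator_sym] moves [LD] from the bounded core function to the possibly unbounded [h]. *)
Lemma generator_Lrev (h g : 'rV[R]_d -> R) : LD h g ->
  Lrev (fun z => h z.2) (fun z => gamma * g z.2).
Proof.
move=> hg; have [hh hgg _] := hg.
apply: (self_adjoint_core Lrev_self_adjoint Lrev_core).
- exact: L2_sections.
- by apply: L2_sections => x; exact: L2Z.
move=> u v Cu Luv; have [//|G HG ->] := @Lrev_pairing u v (fun z => h z.2) Cu Luv.
rewrite [X in X + _](_ : _ = 0) ?add0r; last first.
  rewrite -[RHS](Rintegral_cst1 rho 0); apply: eq_Rintegral => p _ /=.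
  rewrite big1// => x _; rewrite -mulr_suml.
  by have [_ -> _] := Qrev_rates Q_rate p; rewrite mul0r mul0r mulr0.
rewrite inner_sections; last 2 first.
- by move=> x; exact: L2Z.
- by move=> x; exact: Cc_L2.
rewrite mulr_sumr; apply: eq_bigr => x _; rewrite innerZl//; last exact: Cc_L2.
have [M uM] := Cc_infty_bounded (Cu x).
by rewrite mulrCA (generator_sym PD_reversible hg (HG x) uM).
Qed.

Let generator_mean0 u g (M : R) : LD u g -> (forall p, `|u p| <= M) ->
  \int[rho]_p g p = 0.
Proof.
move=> ug uM.
have := generator_sym PD_reversible (generator_cst rho PD 1) ug uM.
rewrite innerC inner1 => ->; rewrite /inner.
by under eq_Rintegral do rewrite mul0r; rewrite Rintegral_cst1.
Qed.

(** On each fibre [a x] is constant, so the [LD] part is a multiple of the mean of an image under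
    the generator, which is 0. *)
Lemma matrix_Lrev (a : S -> R) :
  Lrev (fun z => a z.1) (fun z => \sum_y Qr z.2 z.1 y * a y).
Proof.
have hQa x : L2 rho (fun p => \sum_y Qr p x y * a y).
  apply: L2_sum => y; under [X in L2 rho X]eq_fun do rewrite mulrC.
  by apply: L2Z; exact: Qrev_L2.
have ha x : L2 rho (fun=> a x) by exact: L2_cst.
apply: (self_adjoint_core Lrev_self_adjoint Lrev_core).
- exact: L2_sections.
- exact: L2_sections.
move=> u v Cu Luv; have [//|G HG ->] := @Lrev_pairing u v (fun z => a z.1) Cu Luv.
rewrite [X in _ + gamma * X]big1 ?mulr0 ?addr0; last first.
  move=> x _; have [M uM] := Cc_infty_bounded (Cu x).
  have hG : L2 rho (G x) by have [] := HG x.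
  rewrite /inner /= (@RintegralZl _ _ _ rho setT (G x))//; last exact: L2_integrable.
  by rewrite (generator_mean0 (HG x) uM) !mulr0.
have hu x : L2 rho (fun p => u (x, p)) by exact: Cc_L2.
rewrite inner_sections// Rintegral_sum; last first.
  by move=> x; apply: integrable_scaler; exact: L2M_integrable.
by apply: eq_bigr => x _; rewrite RintegralZl//; exact: L2M_integrable.
Qed.

Lemma gap_Lrev_le_gamma (lambda_p : R) : 0 <= gamma ->
  gap rho LD = lambda_p%:E -> (gap nu Lrev <= (gamma * lambda_p)%:E)%E.
Proof.
move=> g0 gapE; apply/lee_addgt0Pr => e e0.
(* Dividing the slack [e] by [gamma + 1] keeps the quotient meaningful for [gamma = 0], and
   multiplication by [gamma] then costs at most [e]. *)
have g1 : 0 < gamma + 1 by lra.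
have : (gap rho LD < (lambda_p + e / (gamma + 1))%:E)%E.
  by rewrite gapE lte_fin ltrDl divr_gt0.
move=> /ereal_inf_lt[_ [h [g [hg hh0 h0 ->]]]]; rewrite lte_fin => /ltW lt1.
have [hh hgg _] := hg.
have wi (y : R) : \sum_x wt x * y = y by rewrite -mulr_suml sum_wt mul1r.
have E1 : inner nu (fun z => h z.2) (fun z => h z.2) = inner rho h h.
  by rewrite inner_sections//= wi.
have E2 : inner nu (fun z => gamma * g z.2) (fun z => h z.2) = gamma * inner rho g h.
  rewrite inner_sections//; last by move=> x; exact: L2Z.
  by rewrite /= wi innerZl.
apply: (@le_trans _ _ (gamma * (- inner rho g h / inner rho h h))%:E).
  apply: ereal_inf_lbound; exists (fun z => h z.2), (fun z => gamma * g z.2).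
  rewrite E1 E2; split=> //; first exact: generator_Lrev.
    rewrite Rintegral_sections; last by move=> x; exact: L2_integrable.
    by rewrite /= wi.
  by congr EFin; ring.
rewrite -EFinD lee_fin; apply: le_trans (ler_wpM2l g0 lt1) _.
rewrite mulrDr lerD2l mulrA ler_pdivrMr// mulrC ler_pM2l//; lra.
Qed.

(** As [a] does not depend on [p], integrating over [p] replaces [Qrev] by its mean in the Rayleigh
    quotient. *)
Lemma gap_Lrev_le_mean : (gap nu Lrev <= lambda_x_bar pi rho Q)%E.
Proof.
apply: le_ereal_inf_tmp => _ [a [g [ag aa0 a0 ->]]].
have ha x : L2 rho (fun=> a x) by exact: L2_cst.
have hQ x y : ing (fun p => Qr p x y) by apply: L2_integrable; exact: Qrev_L2.
have hQa x : L2 rho (fun p => \sum_y Qr p x y * a y).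
  apply: L2_sum => y; under [X in L2 rho X]eq_fun do rewrite mulrC.
  by apply: L2Z; exact: Qrev_L2.
apply: ereal_inf_lbound.
exists (fun z => a z.1), (fun z => \sum_y Qr z.2 z.1 y * a y).
have E1 : inner nu (fun z => a z.1) (fun z => a z.1) = inner pi a a.
  rewrite inner_sections// /inner Rintegral_discr.
  by apply: eq_bigr => x _; rewrite /= Rintegral_cst1.
have E2 : inner nu (fun z => \sum_y Qr z.2 z.1 y * a y) (fun z => a z.1) =
    inner pi g a.
  rewrite inner_sections// /inner Rintegral_discr; apply: eq_bigr => x _.
  congr (_ * _); rewrite /= RintegralZr//; last exact: L2_integrable.
  congr (_ * _); rewrite ag Rintegral_sum; last first.
    move=> y; under [X in EFin \o X]eq_fun do rewrite mulrC.
    exact: integrable_scaler.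
  by apply: eq_bigr => y _; rewrite RintegralZr.
rewrite E1 E2; split=> //; first exact: matrix_Lrev.
rewrite Rintegral_sections; last by move=> x; exact: (integrable_cstr rho (a x)).
rewrite -[RHS]a0 Rintegral_discr; apply: eq_bigr => x _.
by rewrite /= Rintegral_cst1.
Qed.

Lemma generator_poincare (lambda_p : R) (u g : 'rV[R]_d -> R) (M : R) :
  gap rho LD = lambda_p%:E -> LD u g -> (forall p, `|u p| <= M) ->
  lambda_p * (\int[rho]_p u p ^+ 2 - (\int[rho]_p u p) ^+ 2) <= - inner rho g u.
Proof.
move=> gapE ug uM; have [hu hg _] := ug.
set m := \int[rho]_p u p; pose u0 p := u p - m.
have hu0 : L2 rho u0 by apply: L2B => //; exact: L2_cst.
have u0g : LD u0 g by exact: generator_subc ug.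
have u00 : \int[rho]_p u0 p = 0.
  rewrite RintegralB//; [|exact: L2_integrable|exact: integrable_cstr].
  by rewrite Rintegral_cst1 subrr.
have gu0 : inner rho g u0 = inner rho g u.
  rewrite innerC innerBl//; last exact: L2_cst.
  by rewrite [inner rho (fun=> m) g]RintegralZl ?(generator_mean0 ug uM) ?mulr0
    ?subr0 1?innerC//; exact: L2_integrable.
have u0u0 : inner rho u0 u0 = \int[rho]_p u p ^+ 2 - m ^+ 2.
  rewrite innerBl//; last exact: L2_cst.
  rewrite [inner rho (fun=> m) u0]RintegralZl ?u00 ?mulr0 ?subr0//; last first.
    exact: L2_integrable.
  rewrite innerC innerBl//; last exact: L2_cst.
  by rewrite [inner rho (fun=> m) u]RintegralZl//; exact: L2_integrable.
(* Functions of zero norm are excluded from the infimum defining the gap; for them [u0 = 0] almost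
   everywhere and both sides vanish. *)
rewrite -u0u0 -gu0; have [E0|E0] := eqVneq (inner rho u0 u0) 0.
  have u0ae : {ae rho, forall p, u0 p = 0}.
    have i2 : ing (fun p => u0 p ^+ 2) by have [] := (L2P rho u0).1 hu0.
    have m2 := measurable_int _ i2.
    have /(ae_eq_integral_abs rho measurableT m2) :
        (\int[rho]_p `|(u0 p ^+ 2)%:E| = 0)%E.
      under eq_integral do rewrite gee0_abs ?lee_fin ?sqr_ge0//.
      rewrite -[LHS]fineK; last exact: integrable_fin_num i2.
      by congr EFin; rewrite -[RHS]E0.
    by apply: filterS => p /(_ Logic.I) [] /eqP; rewrite sqrf_eq0 => /eqP.
  rewrite E0 mulr0 [inner rho g u0](_ : _ = 0) ?oppr0//.
  rewrite -[RHS](Rintegral_cst1 rho 0); apply: ae_eq_Rintegral => //.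
    exact: measurable_funM (L2_measurable hg) (L2_measurable hu0).
  by apply: filterS u0ae => p ->; rewrite mulr0.
have p0 : 0 < inner rho u0 u0.
  by rewrite lt_def E0 Rintegral_ge0// => p _; rewrite -expr2 sqr_ge0.
rewrite -ler_pdivlMr// -lee_fin -gapE; apply: ereal_inf_lbound.
by exists u0, g.
Qed.

Lemma Lrev_Cc_poincare (lambda_p l : R) u v :
  gap rho LD = lambda_p%:E -> 0 <= gamma -> 0 < gamma * lambda_p ->
  l <= gamma * lambda_p ->
  (\int[rho]_p ((gamma * lambda_p)%:E /
     (lambda_x pi Q p + (gamma * lambda_p)%:E - l%:E)) <= 1)%E ->
  Cc_infty_prod u -> Lrev u v ->
  l * (inner nu u u - (\int[nu]_x u x) ^+ 2) <= - inner nu v u.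
Proof.
move=> gapE g0 c0 lc G1 Cu Luv.
have hu x : L2 rho (fun p => u (x, p)) by exact: Cc_L2.
have [G HG E] := Lrev_pairing Cu Luv hu.
have hG x : L2 rho (G x) by have [] := HG x.
pose w (x : S) p := u (x, p).
have DE : (fun p => dirichlet pi (Qr p) (w ^~ p)) =
    fun p => - \sum_x wt x * (jump u x p * u (x, p)) by [].
have hD0 : ing (fun p => \sum_x wt x * (jump u x p * u (x, p))).
  apply: integrable_sumr => x; apply: integrable_scaler.
  by apply: L2M_integrable => //; exact: jump_L2.
have hD : ing (fun p => dirichlet pi (Qr p) (w ^~ p)).
  by rewrite DE; exact: integrable_oppr.
have mQ x y := L2_measurable (Qrev_L2 Q_rate x y).
have := poincare_product mQ (Qrev_rates Q_rate) c0 lc G1 hu hD.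
rewrite innerC E inner_sections//.
rewrite Rintegral_sections; last by move=> x; exact: L2_integrable.
move=> H; apply: le_trans H _; rewrite opprD lerD//.
  rewrite -[leRHS]mulN1r -RintegralZl// le_eqVlt; apply/orP; left; apply/eqP.
  by apply: eq_Rintegral => p _; rewrite mulN1r.
rewrite -mulrA -[leRHS]mulrN ler_wpM2l// mulr_sumr -sumrN; apply: ler_sum => x _.
rewrite mulrCA -[leRHS]mulrN ler_wpM2l ?wt_ge0//.
have [M uM] := Cc_infty_bounded (Cu x).
by rewrite innerC; exact: generator_poincare (HG x) uM.
Qed.

End reversible_part.

Theorem proposition4p3 (R : realType) (X : finType) (x0 : X) (d : nat)
  (d_ge1 : (1 <= d)%N)
  (pi : probability (discr x0) R) (rho : probability 'rV[R]_d R)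
  (Q : 'rV[R]_d -> discr x0 -> discr x0 -> R)
  (Q_rate : rate_matrix pi rho Q)
  (mu : discr x0 -> 'rV[R]_d -> 'rV[R]_d)
  (mu_L2 : forall x i, L2 rho (fun p => mu x p 0 i))
  (gamma : R) (gamma_ge0 : 0 <= gamma)
  (PD : R -> R.-pker 'rV[R]_d ~> 'rV[R]_d)
  (PD_semigroup : markov_semigroup rho PD)
  (PD_reversible : reversible rho PD)
  (LD : L2op R 'rV[R]_d)
  (LD_generator : LD = generator rho PD)
  (LD_Cc : forall f : 'rV[R]_d -> R, Cc_infty f -> dom LD f)
  (Phat : R -> R.-pker (discr x0 * 'rV[R]_d)%type ~> (discr x0 * 'rV[R]_d)%type)
  (Phat_semigroup : markov_semigroup (pihat pi rho) Phat)
  (Lhat : L2op R (discr x0 * 'rV[R]_d)%type)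
  (Lhat_generator : Lhat = generator (pihat pi rho) Phat)
  (Lhat_Cc : acts_on_Cc pi rho LD Lhat (Lhat_formula Q mu gamma))
  (Lhat_core : is_core (pihat pi rho) Lhat (@Cc_infty_prod R X x0 d))
  (invariance : drift_invariance pi rho Q mu)
  (F : set (discr x0 * 'rV[R]_d -> R))
  (E : (discr x0 * 'rV[R]_d -> R) -> (discr x0 * 'rV[R]_d -> R) -> R)
  (E_dirichlet : symmetric_dirichlet_form (pihat pi rho) F E)
  (Lrev : L2op R (discr x0 * 'rV[R]_d)%type)
  (Lrev_form : Lrev = form_operator (pihat pi rho) F E)
  (Lrev_self_adjoint : self_adjoint (pihat pi rho) Lrev)
  (Lrev_Cc : acts_on_Cc pi rho LD Lrev (Lrev_formula pi Q gamma))
  (Lrev_core : is_core (pihat pi rho) Lrev (@Cc_infty_prod R X x0 d))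
  (dom_Lhat_Lrev : dom Lhat `<=` dom Lrev)
  (Lhat_Lrev_form : forall f g h, Lhat f g -> Lrev f h ->
     inner (pihat pi rho) f g = inner (pihat pi rho) f h)
  (lambda_p : R) (lambda_pE : gap rho LD = lambda_p%:E)
  (lambda_p_gt0 : 0 < lambda_p) :
  [/\ (gap (pihat pi rho) Lrev <=
         mine (lambda_x_bar pi rho Q) (gamma * lambda_p)%:E)%E,
      exists l, is_lambda_star pi rho Q gamma lambda_p l &
      forall l, is_lambda_star pi rho Q gamma lambda_p l ->
        (l%:E <= gap (pihat pi rho) Lrev)%E].
Proof.
subst LD; rewrite le_min.
have mlam := measurable_lambda_x Q_rate; have lam0 := lambda_x_ge0 Q_rate.
split.
- apply/andP; split.
    exact: (gap_Lrev_le_mean Q_rate PD_reversible LD_Cc Lrev_self_adjoint Lrev_Cc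
      Lrev_core).
  exact: (gap_Lrev_le_gamma Q_rate PD_reversible LD_Cc Lrev_self_adjoint Lrev_Cc
    Lrev_core gamma_ge0 lambda_pE).
- have [g0|g0] := ltP 0 gamma; last first.
    have -> : gamma = 0 by apply/eqP; rewrite eq_le g0.
    by exists 0; split; rewrite ?mul0r ?lexx// ltxx.
  have c0 : 0 < gamma * lambda_p by exact: mulr_gt0.
  set I := (\int[rho]_p (if lambda_x pi Q p == 0 then +oo
    else (gamma * lambda_p)%:E / lambda_x pi Q p))%E.
  have [I1|I1] := boolP (1 < I)%E.
    have [l lI lE] := exists_lambda_star mlam lam0 c0 I1.
    by exists l; split=> // _; rewrite -/I I1.
  exists (gamma * lambda_p); split=> [|_]; first by rewrite ltW//= lexx.
  by rewrite -/I (negbTE I1).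
(* For [gamma = 0] the Poincaré argument, which divides by the weight, has [c = 0]; there [l = 0],
   and the bound is nonnegativity of the Dirichlet form. *)
- move=> l [/andP[l0 lc] Hl]; have [g0|g0] := ltP 0 gamma; last first.
    have g00 : gamma = 0 by apply/eqP; rewrite eq_le g0.
    have -> : l = 0 by apply/eqP; rewrite eq_le l0 andbT (le_trans lc)// g00 mul0r.
    apply: le_ereal_inf_tmp => _ [f [g [Lfg _ _ ->]]]; rewrite lee_fin.
    apply: divr_ge0; last by apply: Rintegral_ge0 => z _; rewrite -expr2 sqr_ge0.
    rewrite Lrev_form in Lfg; have [Ff _ Efg] := Lfg.
    by rewrite -(Efg f Ff); exact: form_ge0 E_dirichlet _ Ff.
  have c0 : 0 < gamma * lambda_p by exact: mulr_gt0.
  apply: (core_variance_bound Lrev_self_adjoint Lrev_core) => u v.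
  apply: (Lrev_Cc_poincare Q_rate PD_reversible LD_Cc Lrev_self_adjoint Lrev_Cc
    lambda_pE gamma_ge0 c0 lc).
  (* When lambda star is the endpoint [gamma * lambda_p], the negated test says that the integral of
     the weight at that level is at most 1. *)
  have := Hl g0; case: ifPn => [_ ->//|+ ->]; rewrite -leNgt; apply: le_trans.
  rewrite le_eqVlt; apply/orP; left; apply/eqP; apply: eq_integral => p _.
  exact: weight_cE.
Qed.
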